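(* Let $G$ be a descending HNN extension of $F_2$ and let $\phi\in\mathrm{Hom}(G,\mathbb{R})\smallsetminus\{0\}$. Suppose that $x,y$ are generators of $F_2$ for which $\phi(x),\phi(y)>0$, and let $g\colon F_2\to F_2$ be a monomorphism such that $G=F_2\ast_g$, with stable letter $t$, and such that $g(x),g(y)$ have no common prefix (as reduced words in $x,y$). Then $[-\phi]\in\Sigma(G)$ if and only if $$\mu_\phi\Big(1+t\,\frac{\partial g(x)}{\partial y}-t\,\frac{\partial g(y)}{\partial y}\Big)=\pm z$$ for some $z\in G$.
   Context: **HNN extensions.** For a monomorphism $g\colon F_2\to F_2$, $F_2\ast_g=\langle F_2,t\mid t^{-1}wt=g(w)\ (w\in F_2)\rangle$; $t$ is the stable letter. **Fox derivatives.** For a basis $s_1,\dots,s_n$ of a free group $F_n$, $\frac{\partial}{\partial s_i}\colon\mathbb{Z}F_n\to\mathbb{Z}F_n$ is the $\mathbb{Z}$-linear map with $\frac{\partial 1}{\partial s_i}=0$, $\frac{\partial s_j}{\partial s_i}=\delta_{ij}$ and $\frac{\partial(vw)}{\partial s_i}=\frac{\partial v}{\partial s_i}+v\frac{\partial w}{\partial s_i}$ for $v,w\in F_n$. Here the basis $x,y$ of $F_2$ is used. **The map $\mu_\phi$.** For a non-zero element $a=\sum_{h\in G}a_h h\in\mathbb{Z}G$, let $\mathrm{supp}(a)=\{h\mid a_h\ne0\}$, $S=\{h\in\mathrm{supp}(a)\mid\phi(h)=\min\phi(\mathrm{supp}(a))\}$ and $\mu_\phi(a)=\sum_{h\in S}a_hh\in\mathbb{Z}G$.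 **BNS invariant.** For a group $G$ with finite generating set $\mathcal S$, $S(G)=(\mathrm{Hom}(G,\mathbb{R})\smallsetminus\{0\})/\mathbb{R}_{>0}$, and $\Sigma(G)$ is the set of $[\phi]\in S(G)$ for which the full subgraph of the Cayley graph $\mathrm{Cay}(G,\mathcal S)$ on the vertices $\{h\in G\mid\phi(h)\ge0\}$ is connected. The convention is that for an epimorphism $\phi\colon G\to\mathbb{Z}$, $[-\phi]\in\Sigma(G)$ iff $G$ is a descending HNN extension over a finitely generated subgroup $B$, with a monomorphism $f\colon B\to B$ and stable letter $t$ satisfying $t^{-1}bt=f(b)$ for $b\in B$, such that $\phi(B)=0$ and $\phi(t)=1$. *)

(* Defs.v *)
From HB Require Import structures.
From mathcomp Require Import monalg.
From mathcomp Require Import all_boot all_order all_algebra.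
From mathcomp Require Import finmap boolp classical_sets reals.

Set Implicit Arguments.
Unset Strict Implicit.
Unset Printing Implicit Defensive.

Import Order.TTheory GRing.Theory Num.Theory.

Local Open Scope classical_set_scope.
Local Open Scope ring_scope.

(** The letter [(s, false)] is the generator [s], and [(s, true)] is its
    formal inverse. *)
Notation letter T := (T * bool)%type.

Section ReducedWords.
Variable T : choiceType.
Implicit Types (l : letter T) (u v w : seq (letter T)).

Definition linv l : letter T := (l.1, ~~ l.2).

Definition reduced w : bool := sorted [rel l m | m != linv l] w.

Lemma linvK : involutive linv.
Proof. by case=> s b; rewrite /linv /= negbK. Qed.

Lemma linv_neq l : linv l != l.
Proof. by case: l => s []; rewrite /linv xpair_eqE /= andbF. Qed.

Lemma linv_eq l m : (m == linv l) = (l == linv m).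
Proof. by rewrite -(inj_eq (can_inj linvK)) linvK eq_sym. Qed.

(** Left multiplication of a reduced word by a letter, with cancellation. *)
Definition lact l w : seq (letter T) :=
  if w is m :: w' then (if m == linv l then w' else l :: w) else [:: l].

Definition wmul u v := foldr lact v u.
Definition winv w := rev (map linv w).

Lemma reduced_behead l w : reduced (l :: w) -> reduced w.
Proof. by case: w => //= m w /andP[]. Qed.

Lemma lact_reduced l w : reduced w -> reduced (lact l w).
Proof.
case: w => //= m w rw; case: eqP => [_|/eqP ne]; last by rewrite /= ne.
exact: reduced_behead rw.
Qed.

Lemma wmul_reduced u v : reduced v -> reduced (wmul u v).
Proof. by move=> rv; elim: u => //= l u; apply: lact_reduced. Qed.

Lemma lact_cons l w : reduced (l :: w) -> lact l w = l :: w.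
Proof. by case: w => //= m w /andP[/negbTE->]. Qed.

Lemma lactK l w : reduced w -> lact (linv l) (lact l w) = w.
Proof.
case: w => [|m w] /= rw; first by rewrite linvK eqxx.
case: (eqVneq m (linv l)) => [e|ne] /=; last by rewrite linvK eqxx.
by subst m; apply: lact_cons.
Qed.

Lemma lactVK l w : reduced w -> lact l (lact (linv l) w) = w.
Proof. by move=> rw; rewrite -{1}(linvK l) lactK. Qed.

Lemma wmul_lact l u v :
  reduced u -> reduced v -> wmul (lact l u) v = lact l (wmul u v).
Proof.
case: u => //= m u ru rv; case: eqP => [->|] //=.
by rewrite lactVK //; apply: wmul_reduced.
Qed.

Lemma wmulA u v w :
  reduced v -> reduced w -> wmul u (wmul v w) = wmul (wmul u v) w.
Proof.
move=> rv rw; elim: u => //= l u ->.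
by rewrite wmul_lact //; apply: wmul_reduced.
Qed.

Lemma wmulw1 w : reduced w -> wmul w [::] = w.
Proof.
elim: w => //= l w IHw rw.
rewrite IHw; last exact: reduced_behead rw.
exact: lact_cons.
Qed.

Lemma winvK : involutive winv.
Proof. by move=> w; rewrite /winv map_rev revK mapK //; apply: linvK. Qed.

Lemma winv_reduced w : reduced w -> reduced (winv w).
Proof.
rewrite /reduced /winv rev_sorted sorted_map; apply: sub_sorted => l m /=.
by rewrite linvK; apply: contraNneq => ->.
Qed.

Lemma wmulV w : reduced w -> wmul (winv w) w = [::].
Proof.
elim: w => //= l w IHw rw; rewrite /winv /= rev_cons -cats1.
rewrite /wmul foldr_cat /= linvK eqxx; apply: IHw; exact: reduced_behead rw.
Qed.

End ReducedWords.

Record freeGroup (T : choiceType) : predArgType :=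
  FreeGroup { fword : seq (letter T); fwordP : reduced fword }.

HB.instance Definition _ (T : choiceType) := [isSub for @fword T].
HB.instance Definition _ (T : choiceType) := [Choice of freeGroup T by <:].

Section FreeGroup.
Variable T : choiceType.
Local Notation F := (freeGroup T).
Implicit Types u v w : F.

Definition fone : F := @FreeGroup T [::] isT.
Definition finv w : F := FreeGroup (winv_reduced (fwordP w)).
Definition fmul u v : F := FreeGroup (wmul_reduced (fword u) (fwordP v)).

Definition fgen (s : T) : F := @FreeGroup T [:: (s, false)] isT.

Fact fmulA : associative fmul.
Proof. by move=> u v w; apply/val_inj/wmulA; apply: fwordP. Qed.
Fact fmul1 : left_id fone fmul.
Proof. by move=> w; apply/val_inj. Qed.
Fact fmulr1 : right_id fone fmul.
Proof. by move=> w; apply/val_inj/wmulw1/fwordP. Qed.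
Fact fmulV : left_inverse fone finv fmul.
Proof. by move=> w; apply/val_inj/wmulV/fwordP. Qed.
Fact fmulrV : right_inverse fone finv fmul.
Proof.
move=> w; have e : finv (finv w) = w by apply/val_inj/winvK.
by rewrite -{1}e fmulV.
Qed.

HB.instance Definition _ :=
  isGroup.Build F fmulA fmul1 fmulr1 fmulV fmulrV.

End FreeGroup.

Section FreeEval.
Local Open Scope group_scope.
Variables (T : choiceType) (G : groupType) (f : T -> G).

Definition leval (l : letter T) : G := if l.2 then (f l.1)^-1 else f l.1.
Definition weval (w : seq (letter T)) : G := \prod_(l <- w) leval l.
Definition feval (w : freeGroup T) : G := weval (fword w).

Lemma leval_linv l : leval (linv l) = (leval l)^-1.
Proof. by case: l => s [] //=; rewrite /leval /= invgK. Qed.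

Lemma weval_lact l w : weval (lact l w) = leval l * weval w.
Proof.
rewrite /weval; case: w => [|m w] /=; first by rewrite big_seq1 big_nil mulg1.
case: eqP => [->|_]; last by rewrite big_cons.
by rewrite big_cons leval_linv mulVKg.
Qed.

Fact feval_is_morphism : {morph feval : u v / u * v}.
Proof.
case=> u ru [v rv]; rewrite /feval /=; elim: u {ru} => [|l u IHu].
  by rewrite [weval [::]]big_nil mul1g.
by rewrite [wmul _ _]/= weval_lact IHu [weval (l :: u)]big_cons mulgA.
Qed.

HB.instance Definition _ :=
  isMultiplicative.Build (freeGroup T) G feval feval_is_morphism.

Lemma feval_gen s : feval (fgen s) = f s.
Proof. by rewrite /feval /weval /= big_seq1. Qed.

End FreeEval.

Section Subgroups.
Local Open Scope group_scope.
Variable G : groupType.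
Implicit Types H A : set G.

Definition subgroup H :=
  [/\ H 1, forall h k, H h -> H k -> H (h * k) & forall h, H h -> H h^-1].

Definition normal_subgroup H :=
  subgroup H /\ forall h k, H h -> H (h ^ k).

Definition generated A : set G :=
  [set h | forall H, subgroup H -> A `<=` H -> H h].

Definition normal_closure A : set G :=
  [set h | forall H, normal_subgroup H -> A `<=` H -> H h].

End Subgroups.

(** [f] exhibits [G] as the group with generators [T] and relators [rels]. *)
Definition is_presentation (T : choiceType) (rels : set (freeGroup T))
    (G : groupType) (f : T -> G) : Prop :=
  (forall h : G, exists w, feval f w = h) /\
  (forall w, feval f w = 1%g <-> normal_closure rels w).

Notation F2 := (freeGroup 'I_2).
Definition ix : 'I_2 := ord0.
Definition iy : 'I_2 := ord_max.

(** Generators of the presentation of an HNN extension of [F2]: [Some ix] and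
    [Some iy] are the basis of [F2], and [None] is the stable letter. *)
Definition hnn_rels (g : F2 -> F2) : set (freeGroup (option 'I_2)) :=
  let j := feval (fun i : 'I_2 => fgen (Some i)) in
  let t := fgen None in
  [set (t^-1 * j w * t * (j (g w))^-1)%g | w in [set: F2]].

(** [G] is the HNN extension [F2 *_g], where [iota] is the canonical map of
    the base group to [G] and [t] is the stable letter. *)
Definition is_hnn (g : F2 -> F2) (G : groupType) (iota : F2 -> G) (t : G) :=
  is_presentation (hnn_rels g)
    (fun o : option 'I_2 => if o is Some i then iota (fgen i) else t).

(** [{malg int[G]}] is the group of finitely supported functions from [G] to the
    integers. The ring structure of [monalg] is restricted to monoids
    without units other than 1, hence the alias with its own product. *)
Definition groupRing (G : groupType) : Type := {malg int[G]}.

HB.instance Definition _ (G : groupType) :=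
  GRing.Zmodule.on (groupRing G).

Section GroupRing.
Variable G : groupType.
Local Notation ZG := (groupRing G).
Implicit Types (a b c : ZG) (h k : G) (z : int).

Definition supp a : {fset G} := msupp a.
Definition gcoeff a h : int := mcoeff h a.
Definition gscal z h : ZG := mkmalgU h z.

(** The group element [h], as an element of the group ring. *)
Definition gelt h : ZG := gscal 1 h.

Definition gone : ZG := gelt 1%g.
Definition gmul a b : ZG :=
  \sum_(h <- supp a) \sum_(k <- supp b)
    gscal (gcoeff a h * gcoeff b k) (h * k)%g.

Lemma gcoeff_gscal z h k : gcoeff (gscal z h) k = z *+ (h == k).
Proof. exact: mcoeffU. Qed.

Lemma groupRingP a b : (forall h, gcoeff a h = gcoeff b h) <-> a = b.
Proof. exact: malgP. Qed.

Lemma gcoeffD a b h : gcoeff (a + b) h = gcoeff a h + gcoeff b h.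
Proof. exact: mcoeffD. Qed.

Lemma gcoeffN a h : gcoeff (- a) h = - gcoeff a h.
Proof. exact: mcoeffN. Qed.

Lemma supp_gcoeff a h : (h \in supp a) = (gcoeff a h != 0).
Proof. by rewrite -mcoeff_neq0. Qed.

Lemma groupRingE a : a = \sum_(h <- supp a) gscal (gcoeff a h) h.
Proof. exact: monalgE. Qed.

Lemma gscal0 h : gscal 0 h = 0.
Proof. exact: monalgU0. Qed.

Lemma gscalD h z1 z2 : gscal (z1 + z2) h = gscal z1 h + gscal z2 h.
Proof. exact: monalgUD. Qed.

Lemma gscalE z h : gscal z h = gelt h *~ z.
Proof.
have Gp n : gscal n%:Z h = gelt h *+ n.
  by rewrite /gelt /gscal -monalgUMn natz.
case: z => n; first exact: Gp.
rewrite NegzE mulrNz -pmulrn -Gp; exact: monalgUN.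
Qed.

End GroupRing.

Section Zlinear.
Variables (G : groupType) (V : zmodType) (f : G -> V).

Definition zlin (a : groupRing G) : V :=
  \sum_(h <- supp a) f h *~ gcoeff a h.

Lemma zlinEw (d : {fset G}) a : (supp a `<=` d)%fset ->
  zlin a = \sum_(h <- d) f h *~ gcoeff a h.
Proof.
move=> le; rewrite /zlin (big_fset_incl _ le) //= => h _.
by rewrite supp_gcoeff negbK => /eqP->; rewrite mulr0z.
Qed.

Fact zlin_is_additive : {morph zlin : a b / a - b}.
Proof.
move=> a b; pose d := (supp a `|` supp b)%fset.
rewrite (@zlinEw d (a - b)) ?(@zlinEw d a) ?(@zlinEw d b) ?fsubsetUl ?fsubsetUr //.
  by rewrite -sumrB; apply: eq_bigr => h _; rewrite gcoeffD gcoeffN mulrzBr.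
exact: msuppB_le.
Qed.

HB.instance Definition _ :=
  GRing.isZmodMorphism.Build (groupRing G) V zlin zlin_is_additive.

Lemma zlin_gelt h : zlin (gelt h) = f h.
Proof.
rewrite (@zlinEw [fset h]%fset); last exact: msuppU_le.
by rewrite big_seq_fset1 gcoeff_gscal eqxx.
Qed.

Lemma zlin_gscal z h : zlin (gscal z h) = f h *~ z.
Proof. by rewrite gscalE raddfMz /= zlin_gelt. Qed.

End Zlinear.

Lemma zlin_unique (G : groupType) (V : zmodType)
    (F : {additive groupRing G -> V}) a : F a = zlin (F \o @gelt G) a.
Proof.
rewrite {1}[a]groupRingE raddf_sum; apply: eq_bigr => h _ /=.
by rewrite gscalE raddfMz.
Qed.

Lemma eq_zlin (G : groupType) (V : zmodType) (f f' : G -> V) :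
  f =1 f' -> zlin f =1 zlin f'.
Proof. by move=> ff' a; apply: eq_bigr => h _; rewrite ff'. Qed.

Lemma raddf_zlin (G : groupType) (V W : zmodType) (f : G -> V)
    (F : {additive V -> W}) a : F (zlin f a) = zlin (F \o f) a.
Proof. by rewrite raddf_sum; apply: eq_bigr => h _; rewrite raddfMz. Qed.

Section GroupRingRing.
Variable G : groupType.
Local Notation ZG := (groupRing G).
Implicit Types (a b c : ZG) (h k : G) (z : int).

Definition glmul h : ZG -> ZG := zlin (fun k => gelt (h * k)%g).

Fact gmulE a b : gmul a b = zlin (fun h => glmul h b) a.
Proof.
apply: eq_bigr => h _; rewrite /glmul [in RHS]/zlin mulrz_suml.
by apply: eq_bigr => k _; rewrite gscalE mulrC mulrzA.
Qed.

Fact gmul_gelt h b : gmul (gelt h) b = glmul h b.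
Proof. by rewrite gmulE zlin_gelt. Qed.

Fact gmulDl : left_distributive (@gmul G) +%R.
Proof. by move=> a b c; rewrite !gmulE raddfD. Qed.

Fact gmulDr : right_distributive (@gmul G) +%R.
Proof.
move=> a b c; rewrite !gmulE /zlin -big_split; apply: eq_bigr => h _ /=.
by rewrite /glmul raddfD mulrzDl.
Qed.

Fact gmul1 : left_id (@gone G) (@gmul G).
Proof.
move=> a; rewrite gmul_gelt [RHS]groupRingE; apply: eq_bigr => k _.
by rewrite mul1g gscalE.
Qed.

Fact gmulr1 : right_id (@gone G) (@gmul G).
Proof.
move=> a; rewrite gmulE [RHS]groupRingE; apply: eq_bigr => h _.
by rewrite /glmul /gone zlin_gelt mulg1 gscalE.
Qed.

Fact glmulM h k b : glmul h (glmul k b) = glmul (h * k)%g b.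
Proof.
rewrite /glmul raddf_zlin; apply: eq_zlin => l /=.
by rewrite zlin_gelt mulgA.
Qed.

Fact gmulA : associative (@gmul G).
Proof.
move=> a b c; rewrite !gmulE raddf_zlin; apply: eq_zlin => h /=.
rewrite /glmul !raddf_zlin; apply: eq_zlin => k /=.
by rewrite zlin_gelt; apply: glmulM.
Qed.

Fact gone_neq0 : gone G != 0.
Proof.
apply/eqP => /groupRingP/(_ 1%g); rewrite gcoeff_gscal eqxx.
by rewrite /gcoeff mcoeff0.
Qed.

HB.instance Definition _ := GRing.Zmodule_isNzRing.Build ZG
  gmulA gmul1 gmulr1 gmulDl gmulDr gone_neq0.

Lemma gelt1 : gelt 1%g = 1 :> ZG.
Proof. by []. Qed.

Lemma geltM h k : gelt (h * k)%g = gelt h * gelt k :> ZG.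
Proof. by rewrite [RHS]gmul_gelt /glmul zlin_gelt. Qed.

End GroupRingRing.

Definition gring_map (G H : groupType) (f : G -> H) :
  groupRing G -> groupRing H := zlin (fun h => gelt (f h)).

Section Fox.
Variables (T : choiceType) (s : T).
Local Notation F := (freeGroup T).
Local Notation ZF := (groupRing F).

Definition lgen (l : letter T) : F := @FreeGroup T [:: l] isT.

(** The derivative of a letter; [0 = d(s^-1 * s) = d(s^-1) + s^-1]. *)
Definition fox_letter (l : letter T) : ZF :=
  if l.1 == s then (if l.2 then - gelt (lgen l) else 1) else 0.

Fixpoint fox_word (w : seq (letter T)) : ZF :=
  if w is l :: w' then fox_letter l + gelt (lgen l) * fox_word w' else 0.

Definition fox : ZF -> ZF := zlin (fun w : F => fox_word (fword w)).

HB.instance Definition _ := GRing.Additive.on fox.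

Lemma fox_gelt (w : F) : fox (gelt w) = fox_word (fword w).
Proof. exact: zlin_gelt. Qed.

Lemma fox1 : fox (gelt 1%g) = 0.
Proof. exact: fox_gelt. Qed.

Lemma fox_gen (r : T) : fox (gelt (fgen r)) = (r == s)%:R.
Proof. by rewrite fox_gelt /= /fox_letter /= mulr0 addr0; case: eqP. Qed.

Lemma lgen_linv l : (lgen l * lgen (linv l))%g = 1%g.
Proof. by apply/val_inj; rewrite /= eqxx. Qed.

Lemma fox_letter_linv l :
  fox_letter l + gelt (lgen l) * fox_letter (linv l) = 0.
Proof.
case: l => r b; rewrite /fox_letter /=; case: eqP => _; last by rewrite mulr0 addr0.
by case: b; rewrite /= ?mulr1 ?addNr // mulrN -geltM lgen_linv gelt1 addrN.
Qed.

Lemma fox_word_lact l w :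
  fox_word (lact l w) = fox_letter l + gelt (lgen l) * fox_word w.
Proof.
case: w => [|m w] //=; case: eqP => [->|//] /=.
by rewrite mulrDr addrA fox_letter_linv add0r mulrA -geltM lgen_linv gelt1 mul1r.
Qed.

Lemma foxM (v w : F) :
  fox (gelt (v * w)%g) = fox (gelt v) + gelt v * fox (gelt w).
Proof.
rewrite !fox_gelt; case: v => v rv /=; elim: v rv => [|l v IHv] rv /=.
  rewrite add0r (_ : FreeGroup rv = 1%g) ?gelt1 ?mul1r //; exact/val_inj.
rewrite fox_word_lact (IHv (reduced_behead rv)) mulrDr addrA; congr (_ + _).
rewrite mulrA -geltM; congr (gelt _ * _); apply/val_inj => /=.
exact: lact_cons.
Qed.

End Fox.

(** The rules above characterise [fox s]. *)
Lemma fox_unique (T : choiceType) (s : T)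
    (D : {additive groupRing (freeGroup T) -> groupRing (freeGroup T)}) :
  D (gelt 1%g) = 0 ->
  (forall r, D (gelt (fgen r)) = (r == s)%:R) ->
  (forall v w : freeGroup T,
     D (gelt (v * w)%g) = D (gelt v) + gelt v * D (gelt w)) ->
  D =1 fox s.
Proof.
move=> D1 Dgen DM a; rewrite (zlin_unique D); apply: eq_zlin => -[w rw] /=.
have Dl l : D (gelt (lgen l)) = fox_letter s l.
  have Df r : D (gelt (lgen (r, false))) = (r == s)%:R by exact: Dgen.
  case: l => r []; last by rewrite Df /fox_letter /=; case: eqP.
  apply: (addIr (gelt (lgen (r, true)) * D (gelt (lgen (r, false))))).
  rewrite -DM (lgen_linv (r, true)) D1 Df /fox_letter /=.
  by case: eqP; rewrite ?mulr1 ?addNr // mulr0 addr0.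
elim: w rw => [|l w IHw] rw /=.
  by rewrite -[RHS]D1; congr (D (gelt _)); apply/val_inj.
rewrite -(IHw (reduced_behead rw)) -Dl -DM; congr (D (gelt _)).
by apply/val_inj; rewrite /= lact_cons.
Qed.

Definition mu (R : realType) (G : groupType) (phi : G -> R) (a : groupRing G) :
    groupRing G :=
  \sum_(h <- supp a | all (fun k => phi h <= phi k) (supp a))
    gscal (gcoeff a h) h.

(** The Cayley graph with edges joining [h] and [s * h]. With edges joining [h]
    and [h * s] instead, the invariant below would be replaced by its image
    under [phi |-> - phi], since inversion exchanges the two graphs. The side is
    determined by the convention that [- phi] lies in the invariant when [G] is
    a descending HNN extension with [t^-1 * b * t = f b], [phi b = 0] and
    [phi t = 1]: an element [t ^+ n * b * t ^- n] is joined to 1, multiplying by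
    one letter at a time on the left, within the elements with [phi <= 0]. *)
Definition cayley (G : groupType) (S : seq G) : rel G :=
  fun h k => has (fun s => (k == s * h)%g || (h == s * k)%g) S.

Definition full_connected (G : eqType) (e : rel G) (V : pred G) : Prop :=
  forall h k, V h -> V k -> exists p, [/\ path e h p, all V p & last h p = k].

Definition Hom (G : groupType) (R : realType) : set (G -> R) :=
  [set phi | forall h k, phi (h * k)%g = phi h + phi k].

Section BNS.
Variables (R : realType) (G : groupType).

Definition nonzero_hom : set (G -> R) :=
  [set phi | Hom phi /\ exists h, phi h != 0].

(** The class of [phi] in the character sphere. *)
Definition ray (phi : G -> R) : set (G -> R) :=
  [set psi | exists2 c : R, 0 < c & forall h, psi h = c * phi h].

Definition Sigma (S : seq G) : set (set (G -> R)) :=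
  [set ray phi | phi in
    [set phi | nonzero_hom phi /\
       full_connected (cayley S) (fun h => 0 <= phi h)]].

End BNS.

(* Main.v *)
Require Import Defs.
From HB Require Import structures.
From mathcomp Require Import all_boot all_order all_algebra.
From mathcomp Require Import finmap boolp classical_sets filter reals.
From mathcomp Require Import zify lra.

Set Implicit Arguments.
Unset Strict Implicit.
Unset Printing Implicit Defensive.

Import Order.TTheory GRing.Theory Num.Theory.
Local Open Scope ring_scope.

(** Write [a = 1 + t A - t B] with [A = dg(x)/dy], [B = dg(y)/dy]. By the prefix
    hypothesis the supports of [1], [t A] and [t B] are disjoint, so that no
    cancellation occurs in [a]. A chain in the Cayley graph on [x], [y], [t] is a
    triple over ZG. Since [phi x > 0], the relation [x t = t g(x)] replaces
    [t - 1] by [x^n (t - 1)] modulo the [x]- and [y]-edges; substituted in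
    [y t = t g(y)], it yields a relation in which the coefficient of [y - 1] has
    the same leading term as [a].

    If this leading term is [+-z], it can be inverted, and every chain whose
    boundary is far up can be moved far up: the half space is connected.
    Conversely, if the half space is connected, a path joining [x^n] to [y x^n]
    high up closes to a loop, which is a product of conjugates of relators. Its
    Fox derivatives give [v] with leading term [v0] such that [v0 * mu a + 1] has
    no terms at the lowest level. By a unique product argument, for which a
    left-invariant preorder on [G] separating the support of [a] suffices, [mu a]
    is a monomial with invertible coefficient. *)

(** * A left order on free groups *)

Section TreeOrder.
Variable T : countType.
Implicit Types (l m : letter T) (u v w p : seq (letter T)).

Definition edge_sign l : int := if l.2 then -1 else 1.

(** The edges leaving a vertex of the Cayley tree are ordered by [pickle]. A path entering along [l]
    and leaving along [m] has [linv l] behind it and [m] ahead of it, and the sign compares these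
    two edges. *)
Definition turn l m : int :=
  if (choice.pickle (linv l) < choice.pickle m)%N then 1 else -1.

Definition junction u v : int :=
  match rev u, v with l :: _, m :: _ => turn l m | _, _ => 0 end.

Fixpoint tree_weight w : int :=
  if w is l :: w' then edge_sign l + junction [:: l] w' + tree_weight w' else 0.

Lemma junction_nil u : junction u [::] = 0.
Proof. by rewrite /junction; case: (rev u). Qed.

Lemma tree_weight_cat u v :
  tree_weight (u ++ v) = tree_weight u + junction u v + tree_weight v.
Proof.
elim: u => [|l [|l' u] IHu] /=.
- by rewrite /junction /= !add0r.
- by rewrite junction_nil addr0 addr0.
rewrite /= in IHu; rewrite IHu.
have -> : junction [:: l, l' & u] v = junction (l' :: u) v.
  by rewrite /junction !rev_cons; case/lastP: u {IHu} => [|u l0];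
     rewrite ?rev_rcons.
by rewrite /= !addrA.
Qed.

Lemma turn_linv l m : m != linv l -> turn (linv m) (linv l) = - turn l m.
Proof.
rewrite /turn linvK => ne.
have : choice.pickle m != choice.pickle (linv l).
  by rewrite (inj_eq (pcan_inj choice.pickleK)).
by rewrite neq_ltn => /orP[lt|lt]; rewrite lt ltnNge ltnW ?opprK.
Qed.

(** Reversing a path flips every edge and, since a reduced word never backtracks, every turn. *)
Lemma tree_weight_inv w : reduced w -> tree_weight (winv w) = - tree_weight w.
Proof.
elim: w => [|l w IHw] rw; first by rewrite oppr0.
rewrite /winv map_cons rev_cons -cats1 tree_weight_cat.
rewrite [tree_weight (rev _)](IHw (reduced_behead rw)).
have -> : tree_weight [:: linv l] = - edge_sign l.
  by case: l {rw} => s []; rewrite /= junction_nil.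
have -> : junction (rev (map (@linv T) w)) [:: linv l] = - junction [:: l] w.
  rewrite /junction revK; case: w rw {IHw} => [|m w] //= /andP[ne _].
  exact: turn_linv.
rewrite /=; lia.
Qed.

(** A word of [n > 0] letters has [n] edges and [n - 1] turns, each counted as [1] or [-1], so its
    weight is odd. *)
Lemma tree_weight_eq0 w : tree_weight w = 0 -> w = [::].
Proof.
have odd_weight l w' : exists k, tree_weight (l :: w') = k *+ 2 + 1.
  elim: w' l => [|m w' IHw] l.
    rewrite /= junction_nil /edge_sign; case: l.2; [exists (-1)|exists 0]; lia.
  have [k /= ->] := IHw m; rewrite /junction /= /edge_sign /turn.
  by do 2![case: ifP => _]; [exists k|exists (k - 1)|exists (k+1)|exists k]; lia.
by case: w => // l w; have [k ->] := odd_weight l w => ?; lia.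
Qed.

Lemma wmul_cancel u v : reduced u -> reduced v ->
  exists u' p v', [/\ u = u' ++ p, v = winv p ++ v' & wmul u v = u' ++ v'].
Proof.
move=> + rv; elim: u => [|l u IHu] ru; first by exists [::], [::], v.
have [u' [p [v' [eu ev e]]]] := IHu (reduced_behead ru).
rewrite [wmul _ _]/= e; case: u' eu e => [|a u'] /= eu e.
  case: v' ev e => [|m v'] ev e; first by exists [:: l], p, [::]; rewrite eu.
  rewrite /=; case: eqP => [em|_]; last by exists [:: l], p, (m :: v'); rewrite eu.
  exists [::], (l :: p), v'; split; rewrite ?eu //.
  by rewrite ev em /winv map_cons rev_cons cat_rcons.
exists (l :: a :: u'), p, v'; split; rewrite ?eu //.
by move: ru; rewrite eu /= => /andP[/negbTE-> _].
Qed.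

(** Transitivity at the vertex: if [linv l < q < m], the subtracted turn is [1] as well. *)
Lemma turn_triangle l q m : turn l q + turn (linv q) m - turn l m <= 1.
Proof. by rewrite /turn linvK; do 3![case: ifP => ?]; lia. Qed.

(* The defect of [tree_weight] only sees the three turns at the branch point of
   the tripod spanned by 1, [u] and [u * v] in the Cayley tree. *)
Lemma tree_weight_mul u v : reduced u -> reduced v ->
  tree_weight u + tree_weight v - 1 <= tree_weight (wmul u v).
Proof.
move=> ru rv; have [u' [p [v' [eu ev ->]]]] := wmul_cancel ru rv.
have rp : reduced p.
  by rewrite -[p]winvK; apply/winv_reduced; move: rv; rewrite ev => /cat_sorted2[].
rewrite eu ev !tree_weight_cat (tree_weight_inv rp).
suff : junction u' p + junction (winv p) v' - junction u' v' <= 1 by lia.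
rewrite /junction /winv revK.
case: (rev u') => [|l ?]; case: p {eu ev rp} => [|q p];
  case: v' => [|m ?] //=; rewrite ?turn_triangle // /turn;
  by repeat case: ifP => ?; lia.
Qed.

Definition fpos (w : freeGroup T) : bool := 0 <= tree_weight (fword w).

Lemma fpos1 : fpos 1%g.
Proof. by []. Qed.

(** A nontrivial nonnegative word has weight at least [1], which absorbs the defect [1] of
    [tree_weight_mul]. *)
Lemma fposM (w w' : freeGroup T) : fpos w -> fpos w' -> fpos (w * w')%g.
Proof.
rewrite /fpos; have [e|ne] := eqVneq (tree_weight (fword w)) 0.
  have -> : w = 1%g by apply/val_inj/tree_weight_eq0.
  by rewrite mul1g.
have [e|ne'] := eqVneq (tree_weight (fword w')) 0.
  have -> : w' = 1%g by apply/val_inj/tree_weight_eq0.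
  by rewrite mulg1.
have /= := tree_weight_mul (fwordP w) (fwordP w'); lia.
Qed.

Lemma fpos_total (w : freeGroup T) : fpos w || fpos w^-1%g.
Proof. by rewrite /fpos /= tree_weight_inv ?fwordP //; lia. Qed.

Lemma fpos_antisym (w : freeGroup T) : fpos w -> fpos w^-1%g -> w = 1%g.
Proof.
rewrite /fpos /= tree_weight_inv ?fwordP // => pos neg.
have w0 : tree_weight (fword w) = 0 by lia.
exact/val_inj/tree_weight_eq0.
Qed.

End TreeOrder.

(** * A left-invariant preorder on HNN extensions of [F2] *)

Section MultiplicativeGroup.
Local Open Scope group_scope.
Variables (H K : groupType) (f : {multiplicative H -> K}).

Lemma mult1 : f 1 = 1.
Proof. by apply: (mulgI (f 1)); rewrite -gmulfM !mulg1. Qed.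

Lemma multV : {morph f : h / h^-1}.
Proof. by move=> h; apply: (mulgI (f h)); rewrite -gmulfM !mulgV mult1. Qed.

End MultiplicativeGroup.

Lemma freeGroup_ind (T : choiceType) (P : freeGroup T -> Prop) :
  P 1%g -> (forall s, P (fgen s)) ->
  (forall u v, P u -> P v -> P (u * v)%g) -> (forall u, P u -> P u^-1%g) ->
  forall w, P w.
Proof.
move=> P1 Pg PM PV [w rw]; elim: w rw => [|l w IHw] rw.
  by have -> : FreeGroup rw = 1%g by apply/val_inj.
have -> : FreeGroup rw = (lgen l * FreeGroup (reduced_behead rw))%g.
  by apply/val_inj; rewrite /= lact_cons.
apply: (PM) => //; case: l {rw} => s [].
  by have -> : lgen (s, true) = (fgen s)^-1%g; [apply/val_inj | apply/PV/Pg].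
by have -> : lgen (s, false) = fgen s; [apply/val_inj | apply/Pg].
Qed.

Lemma free_mult_ext (T : choiceType) (H : groupType)
    (f f' : {multiplicative freeGroup T -> H}) :
  (forall s, f (fgen s) = f' (fgen s)) -> f =1 f'.
Proof.
move=> ff'; apply: freeGroup_ind => [|//|u v eu ev|u eu].
- by rewrite !mult1.
- by rewrite !gmulfM eu ev.
- by rewrite !multV eu.
Qed.

(** * The unrestricted wreath product with the integers, and germs at infinity *)

Definition wreathZ (H : groupType) : Type := ((int -> H) * int)%type.

Section WreathZ.
Variable H : groupType.
Local Notation W := (wreathZ H).
Local Open Scope group_scope.

HB.instance Definition _ := Choice.copy W ((int -> H) * int)%type.

Definition wone : W := (fun _ => 1, 0%R).
Definition wreath_mul (a b : W) : W :=
  (fun n => a.1 n * b.1 (n + a.2)%R, (a.2 + b.2)%R).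
Definition wreath_inv (a : W) : W :=
  (fun n => (a.1 (n - a.2)%R)^-1, (- a.2)%R).

Fact wreath_mulA : associative wreath_mul.
Proof.
move=> a b c; congr (_, _); last exact: addrA.
by apply/funext => n /=; rewrite mulgA addrA.
Qed.
Fact wreath_mul1 : left_id wone wreath_mul.
Proof.
case=> s d; congr (_, _) => /=; last exact: add0r.
by apply/funext => n; rewrite mul1g addr0.
Qed.
Fact wreath_mulr1 : right_id wone wreath_mul.
Proof.
case=> s d; congr (_, _) => /=; last exact: addr0.
by apply/funext => n; rewrite mulg1.
Qed.
Fact wreath_mulV : left_inverse wone wreath_inv wreath_mul.
Proof.
case=> s d; congr (_, _) => /=; last exact: addNr.
by apply/funext => n; rewrite mulVg.
Qed.
Fact wreath_mulrV : right_inverse wone wreath_inv wreath_mul.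
Proof.
case=> s d; congr (_, _) => /=; last exact: addrN.
by apply/funext => n; rewrite addrK mulgV.
Qed.

HB.instance Definition _ :=
  isGroup.Build W wreath_mulA wreath_mul1 wreath_mulr1 wreath_mulV wreath_mulrV.

(** Dividing by this normal subgroup leaves the germs of sequences at [+oo], together with the
    shift. *)
Definition tail_trivial (a : W) : Prop :=
  a.2 = 0%R /\ exists N : int, forall n, (N <= n)%R -> a.1 n = 1.

Lemma tail_trivial_normal : normal_subgroup tail_trivial.
Proof.
split; first split.
- by split => //; exists 0%R.
- move=> [a d] [b e] [/= -> [N aN]] [/= -> [M bM]]; split => /=.
    by rewrite addr0.
  by exists (Num.max N M) => n; rewrite ge_max addr0 => /andP[/aN-> /bM->];
     rewrite mulg1.
- move=> [a d] [/= -> [N aN]]; split => /=; first by rewrite oppr0.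
  by exists N => n /aN e; rewrite subr0 e invg1.
move=> [a d] [b e] [/= -> [N aN]]; split => /=; first by rewrite add0r addNr.
exists (N + e)%R => n le; rewrite addr0 aN ?mul1g ?mulVg //.
by rewrite lerBrDr.
Qed.

End WreathZ.

Section HNN.
Variables (g : {multiplicative F2 -> F2}) (g_inj : injective g).

(* [F2] embeds in the germs at infinity of sequences by w |-> (g^n w)_n, and
   conjugation by the shift then induces [g]; a sequence of words is declared
   nonnegative when it is so along a fixed ultrafilter. *)
Definition hnn_wreath_gen (o : option 'I_2) : wreathZ F2 :=
  if o is Some i then (fun n => iter (absz n) g (fgen i), 0) else (fun _ => 1%g, -1).

Let ev : {multiplicative freeGroup (option 'I_2) -> wreathZ F2} :=
  feval hnn_wreath_gen.
Let j : {multiplicative F2 -> freeGroup (option 'I_2)} :=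
  feval (fun i : 'I_2 => fgen (Some i)).

Lemma iter_mult n : {morph iter n g : u v / (u * v)%g}.
Proof. by elim: n => // n IHn u v; rewrite !iterS IHn gmulfM. Qed.

Lemma ev_base w : ev (j w) = (fun n => iter (absz n) g w, 0).
Proof.
pose E (w : F2) : wreathZ F2 := (fun n => iter (absz n) g w, 0).
have EM : {morph E : u v / (u * v)%g}.
  move=> u v; congr (_, _); apply/funext => n /=.
  by rewrite addr0 iter_mult.
pose E' : {multiplicative F2 -> wreathZ F2} :=
  HB.pack E (isMultiplicative.Build _ _ E EM).
apply: (@free_mult_ext _ _ (ev \o j) E') => s /=.
by rewrite feval_gen feval_gen.
Qed.

Lemma ev_stable : ev (fgen None) = (fun _ => 1%g, -1).
Proof. exact: feval_gen. Qed.

(** At [n] the relator of [w] takes the value [g^|n+1|(w) * (g^|n|(g w))^-1], which is trivial for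
    [n >= 0]. Passing to germs discards the negative indices. *)
Lemma hnn_rels_tail_trivial u :
  normal_closure (hnn_rels g) u -> tail_trivial (ev u).
Proof.
move=> ncu; have [[W1 WM WV] WJ] := tail_trivial_normal F2.
have nK : normal_subgroup [set u | tail_trivial (ev u)]%classic.
  split; first split=> [|h k|h].
  - by rewrite /= mult1.
  - by rewrite /= gmulfM; apply: WM.
  - by rewrite /= multV; apply: WV.
  - by move=> h k; rewrite /= !gmulfM multV; apply: WJ.
apply: (ncu _ nK) => _ [w _ <-].
suff: tail_trivial (ev ((fgen None)^-1 * j w * fgen None * (j (g w))^-1)%g) by [].
rewrite !gmulfM !multV !ev_base ev_stable; split=> /=.
  by rewrite !(addr0, add0r, oppr0, opprK) subrr.
exists 0 => n n0; rewrite invg1 mul1g mulg1.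
have -> : n + (- (-1) + 0 - 1) - 0 = n by lia.
have -> : absz (n - -1)%R = (absz n).+1 by lia.
by rewrite iterSr mulgV.
Qed.

Definition wreath_pos (U : set_system nat) (a : wreathZ F2) : Prop :=
  0 < a.2 \/ a.2 = 0 /\ U [set n : nat | fpos (a.1 n%:Z)]%classic.

Section Ultra.
Variables (U : set_system nat) (UU : UltraFilter U).
Hypothesis U_tail : forall N : nat, U [set n : nat | (N <= n)%N]%classic.
Local Notation pos := (wreath_pos U).

Lemma wreath_posM a b : pos a -> pos b -> pos (a * b)%g.
Proof.
case: a b => [a d] [b e]; rewrite /wreath_pos /= => -[d0|[-> pa]] [e0|[-> pb]].
- by left; rewrite addr_gt0.
- by left; rewrite addr0.
- by left; rewrite add0r.
right; rewrite addr0; split => //.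
apply: filterS (filterI pa pb) => n [an bn] /=.
by rewrite addr0; apply: fposM.
Qed.

(** An ultrafilter contains each set or its complement, which also decides sequences whose sign
    oscillates forever. *)
Lemma wreath_pos_total a : pos a \/ pos a^-1%g.
Proof.
case: a => [a d]; rewrite /wreath_pos /= oppr_gt0.
case: (ltgtP d 0) => [d0|d0|->]; [by right; left|by left; left|].
have [pa|na] := in_ultra_setVsetC [set n : nat | fpos (a n%:Z)]%classic UU.
  by left; right.
right; right; split; first by rewrite oppr0.
apply: filterS na => n /= /negP na.
by rewrite subr0; have := fpos_total (a n); rewrite (negbTE na).
Qed.

Lemma tail_trivial_pos a : tail_trivial a -> pos a.
Proof.
case: a => [a d] [/= -> [N aN]]; right; split => //.
by apply: filterS (U_tail (absz N)) => n /= le; rewrite aN ?fpos1 //; lia.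
Qed.

(** If both signs hold along [U], then some [g^n(w)] has both signs and equals [1]; injectivity of
    [g] brings this down to [w]. *)
Lemma wreath_pos_base w : pos (ev (j w)) -> pos (ev (j w))^-1%g -> w = 1%g.
Proof.
rewrite ev_base /wreath_pos /= => -[//|[_ pw]] [//|[_ nw]].
have [n [/= pn nn]] := filter_ex (filterI pw nw).
have := fpos_antisym pn; rewrite addn0 in nn => /(_ nn) /=.
elim: n {pn nn} => //= n IHn; rewrite -[1%g in RHS](mult1 g) => /g_inj.
exact: IHn.
Qed.

Lemma wreath_pos_stable w :
  pos (ev (fgen None * j w)%g) -> pos (ev (fgen None * j w)%g)^-1%g -> False.
Proof.
by rewrite gmulfM ev_stable ev_base /wreath_pos /= => -[//|[//]].
Qed.

End Ultra.

Lemma nat_ultrafilter : exists U : set_system nat,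
  UltraFilter U /\ forall N : nat, U [set n : nat | (N <= n)%N]%classic.
Proof.
pose F : set_system nat :=
  [set A | exists N, forall n : nat, (N <= n)%N -> A n]%classic.
have PF : ProperFilter F.
  apply: Build_ProperFilter_ex; first by move=> A [N AN]; exists N; apply: AN.
  split.
  - by exists 0%N.
  - move=> A B [N AN] [M BM]; exists (maxn N M) => n.
    by rewrite geq_max => /andP[/AN ? /BM ?].
  - by move=> A B AB [N AN]; exists N => n /AN/AB.
have [U [UU FU]] := ultraFilterLemma PF.
by exists U; split => // N; apply: FU; exists N.
Qed.

(** [pos] is the cone of a total left-invariant preorder, in which [h <= k] means [pos (h^-1 * k)].
    The last two clauses give antisymmetry among [1] and the elements [t * iota w], which is where
    the support of [a] lies. *)
Lemma hnn_preorder (G : groupType) (iota : {multiplicative F2 -> G}) (t : G) :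
  is_hnn g iota t ->
  exists pos : G -> Prop,
    [/\ forall h k, pos h -> pos k -> pos (h * k)%g,
        forall h, pos h \/ pos h^-1%g,
        forall w, pos (iota w) -> pos (iota w)^-1%g -> w = 1%g
      & forall w, pos (t * iota w)%g -> pos (t * iota w)^-1%g -> False].
Proof.
case; set f : option _ -> G := fun o => _ => surj ker.
pose ff : {multiplicative freeGroup (option 'I_2) -> G} := feval f.
have fj w : ff (j w) = iota w.
  apply: (@free_mult_ext _ _ (ff \o j) iota) => s /=.
  by rewrite feval_gen feval_gen.
have ft : ff (fgen None) = t by exact: feval_gen.
have [U [UU U_tail]] := nat_ultrafilter.
pose pos h := exists2 u, ff u = h & wreath_pos U (ev u).
(* The sign does not depend on the word chosen for [h]: two words differ by an element of the normal
   closure of the relators, whose image is [tail_trivial] and thus nonnegative. *)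
have posE h u : ff u = h -> pos h -> wreath_pos U (ev u).
  move=> fu [v fv pv]; rewrite -[u](mulVKg v) gmulfM.
  apply: wreath_posM => //; apply/(tail_trivial_pos UU U_tail).
  apply/hnn_rels_tail_trivial/ker; rewrite -/(ff _).
  by rewrite gmulfM multV fu fv mulVg.
exists pos; split.
- move=> h k [u <- pu] [v <- pv]; exists (u * v)%g; first exact: gmulfM.
  by rewrite gmulfM; apply: wreath_posM.
- move=> h; have [u <-] := surj h.
  have [pu|nu] := wreath_pos_total UU (ev u); first by left; exists u.
  by right; exists u^-1%g; rewrite multV.
- move=> w pw nw; apply: (@wreath_pos_base U UU).
    exact: posE (fj w) pw.
  by rewrite -multV; apply: posE nw; rewrite multV fj.
- move=> w pw nw; apply: (@wreath_pos_stable U w).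
    by apply: posE pw; rewrite gmulfM fj ft.
  by rewrite -multV; apply: posE nw; rewrite multV gmulfM fj ft.
Qed.

End HNN.

(** * Group rings and unique products *)

Section GroupRingCoefficients.
Variable G : groupType.
Local Notation ZG := (groupRing G).
Implicit Types (a b : ZG) (h k : G).

Lemma gcoeff0 h : gcoeff (0 : ZG) h = 0.
Proof. by have := gcoeffD (0 : ZG) 0 h; rewrite addr0 => /esym; lia. Qed.

Lemma gcoeff_sum (I : Type) (r : seq I) (P : pred I) (F : I -> ZG) h :
  gcoeff (\sum_(i <- r | P i) F i) h = \sum_(i <- r | P i) gcoeff (F i) h.
Proof.
apply: (big_morph (fun a => gcoeff a h)); last exact: gcoeff0.
by move=> a b; apply: gcoeffD.
Qed.

Lemma gcoeff_gelt h k : gcoeff (gelt h) k = (h == k)%:R.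
Proof. exact: gcoeff_gscal. Qed.

Lemma gcoeff_out a h : h \notin supp a -> gcoeff a h = 0.
Proof. by rewrite supp_gcoeff negbK => /eqP. Qed.

Lemma gcoeffM a b h :
  gcoeff (a * b) h = \sum_(k <- supp a) gcoeff a k * gcoeff b (k^-1 * h)%g.
Proof.
rewrite [a * b]/(gmul a b) gcoeff_sum; apply: eq_bigr => k _.
rewrite gcoeff_sum; under eq_bigr => l _ do rewrite gcoeff_gscal.
have eqE l : (k * l == h)%g = (l == k^-1 * h)%g.
  by apply/eqP/eqP => [<-|->]; rewrite ?mulKg ?mulVKg.
under eq_bigr => l _ do rewrite eqE.
have [kh|kh] := boolP ((k^-1 * h)%g \in supp b).
  rewrite (bigD1_seq _ kh) ?fset_uniq //= eqxx big1_seq ?addr0 //.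
  by move=> l /andP[/negbTE-> _].
rewrite (gcoeff_out kh) mulr0 big1_seq // => l /andP[_ lb].
by case: eqP => // e; rewrite e (negbTE kh) in lb.
Qed.

Lemma supp_gelt h : supp (gelt h) = [fset h]%fset.
Proof.
by apply/fsetP => k; rewrite supp_gcoeff gcoeff_gelt in_fset1 (eq_sym k); case: (h == k).
Qed.

Lemma gcoeff_geltM h a k : gcoeff (gelt h * a) k = gcoeff a (h^-1 * k)%g.
Proof. by rewrite gcoeffM supp_gelt big_seq_fset1 gcoeff_gelt eqxx mul1r. Qed.

Lemma gcoeffM_gelt h a k : gcoeff (a * gelt h) k = gcoeff a (k * h^-1)%g.
Proof.
rewrite gcoeffM; under eq_bigr => l _ do rewrite gcoeff_gelt.
have eqE l : (h == l^-1 * k)%g = (l == k * h^-1)%g.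
  by apply/eqP/eqP => ->; rewrite ?invgM ?invgK ?mulVKg ?mulgVK.
under eq_bigr => l _ do rewrite eqE.
have [kh|kh] := boolP ((k * h^-1)%g \in supp a).
  rewrite (bigD1_seq _ kh) ?fset_uniq //= eqxx mulr1 big1_seq ?addr0 //.
  by move=> l /andP[/negbTE-> _]; rewrite mulr0.
rewrite (gcoeff_out kh) big1_seq // => l /andP[_ la].
by case: eqP => [e|]; rewrite ?mulr0 // e (negbTE kh) in la *.
Qed.

Lemma suppM a b h : h \in supp (a * b) ->
  exists k l, [/\ k \in supp a, l \in supp b & h = (k * l)%g].
Proof.
rewrite supp_gcoeff gcoeffM => ne.
have [/hasP[k ka kb]|/hasPn no] := boolP
    (has (fun k => gcoeff b (k^-1 * h)%g != 0) (supp a)).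
  by exists k, (k^-1 * h)%g; rewrite mulVKg; split=> //; rewrite supp_gcoeff.
move: ne; rewrite big1_seq ?eqxx // => k /andP[_ /no].
by rewrite negbK => /eqP->; rewrite mulr0.
Qed.

Lemma suppD a b h : h \in supp (a + b) -> h \in supp a \/ h \in supp b.
Proof.
rewrite !supp_gcoeff gcoeffD; have [->|] := eqVneq (gcoeff a h) 0.
  by rewrite add0r; right.
by left.
Qed.

Lemma suppN a : supp (- a) = supp a.
Proof. by apply/fsetP => h; rewrite !supp_gcoeff gcoeffN oppr_eq0. Qed.

Lemma groupRing_ind (P : ZG -> Prop) :
  (forall h, P (gelt h)) -> (forall a b, P a -> P b -> P (a - b)) ->
  forall a, P a.
Proof.
move=> Pg PB; have P0 : P 0 by rewrite -(subrr (gelt 1%g)); apply: PB.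
have PN a : P a -> P (- a) by rewrite -sub0r; apply: PB.
have PD a b : P a -> P b -> P (a + b).
  by move=> Pa /PN Pb; rewrite -[b]opprK; apply: PB.
have Pn a n : P a -> P (a *+ n).
  by move=> Pa; elim: n => // n; rewrite mulrS; apply: PD.
move=> a; rewrite [a]groupRingE; elim/big_ind: _ => // h _.
rewrite gscalE; case: (gcoeff a h) => n; first exact: Pn.
by rewrite NegzE mulrNz; apply/PN/Pn.
Qed.

End GroupRingCoefficients.

Section GringMap.
Variables (G H : groupType).

Lemma gring_mapB (f : G -> H) : {morph gring_map f : a b / a - b}.
Proof. exact: zlin_is_additive. Qed.

Lemma gring_map_gelt (f : G -> H) h : gring_map f (gelt h) = gelt (f h).
Proof. exact: zlin_gelt. Qed.

Lemma gring_mapM (f : {multiplicative G -> H}) a b :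
  gring_map f (a * b) = gring_map f a * gring_map f b.
Proof.
elim/groupRing_ind: a => [h|a a' ea ea']; last by rewrite mulrBl !gring_mapB ea ea' mulrBl.
elim/groupRing_ind: b => [k|b b' eb eb']; last by rewrite mulrBr !gring_mapB eb eb' mulrBr.
by rewrite -geltM !gring_map_gelt gmulfM geltM.
Qed.

Lemma supp_gring_map (f : G -> H) a k : k \in supp (gring_map f a) ->
  exists2 h, h \in supp a & k = f h.
Proof.
rewrite supp_gcoeff /gring_map /zlin gcoeff_sum => ne.
have [/hasP[h ha /eqP->]|/hasPn no] := boolP (has (fun h => k == f h) (supp a)).
  by exists h.
move: ne; rewrite big1_seq ?eqxx // => h /andP[_ /no ne].
by rewrite -gscalE gcoeff_gscal eq_sym (negbTE ne).
Qed.

End GringMap.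

Lemma exists_max (T : eqType) (le : T -> T -> Prop) (s : seq T) :
  (forall x y, le x y \/ le y x) ->
  (forall x y z, le x y -> le y z -> le x z) -> s != [::] ->
  exists2 x, x \in s & forall y, y \in s -> le y x.
Proof.
move=> tot tr; have refl x : le x x by case: (tot x x).
elim: s => // x [_ _|y s IHs _].
  by exists x; rewrite ?mem_head // => y; rewrite inE => /eqP->.
have [z zs zmax] := IHs isT; have [xz|zx] := tot x z.
  exists z; first by rewrite in_cons zs orbT.
  by move=> w; rewrite in_cons => /predU1P[->|/zmax].
exists x; first exact: mem_head.
by move=> w; rewrite in_cons => /predU1P[->|/zmax /tr]; [|apply].
Qed.

Section UniqueProducts.
Variables (G : groupType) (le : G -> G -> Prop).
Hypothesis le_total : forall h k, le h k \/ le k h.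
Hypothesis le_trans : forall h k l, le h k -> le k l -> le h l.
Hypothesis le_mul : forall h k l, le k l -> le (h * k)%g (h * l)%g.
Local Notation ZG := (groupRing G).

(** Take [k] maximal in [supp b], and only then [h] with [h * k] maximal, because the preorder is
    not right-invariant. If [h * k = l * m] with [l] in [supp v] and [m] in [supp b], then
    [l * k <= l * m], so [k <= m] and hence [m = k], [l = h]: the product arises once and does not
    cancel. *)
Lemma max_product (v b : ZG) : v != 0 -> b != 0 ->
  {in supp b &, forall k l, le k l -> le l k -> k = l} ->
  exists h k, [/\ h \in supp v, k \in supp b, (h * k)%g \in supp (v * b),
    forall l, l \in supp b -> le l k & forall l, l \in supp v -> le (l * k)%g (h * k)%g].
Proof.
have supp_neq0 (c : ZG) : c != 0 -> enum_fset (supp c) != [::].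
  apply: contraNneq => e; apply/eqP/groupRingP => h.
  have no : h \notin enum_fset (supp c) by rewrite e.
  by rewrite gcoeff0; apply: gcoeff_out.
move=> /supp_neq0 v0 /supp_neq0 b0 anti.
have [k kb kmax] := exists_max le_total le_trans b0.
have [h hv hmax] := @exists_max _ (fun h l => le (h * k)%g (l * k)%g) _
  (fun _ _ => le_total _ _) (fun _ _ _ => @le_trans _ _ _) v0.
exists h, k; split=> //; rewrite supp_gcoeff gcoeffM.
rewrite (bigD1_seq _ hv) ?fset_uniq //= mulKg big1_seq ?addr0.
  by rewrite mulf_neq0 // -supp_gcoeff.
move=> l /andP[ne lv]; apply/eqP; rewrite mulf_eq0 orbC.
apply/orP; left; apply: contraNT ne; rewrite -supp_gcoeff => lb.
have e : (l^-1 * (h * k))%g = k.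
  apply: anti => //; first exact: kmax.
  by have := le_mul l^-1%g (hmax l lv); rewrite mulKg.
by apply/eqP/(mulIg k); rewrite -[in LHS]e mulVKg.
Qed.

End UniqueProducts.

(** [max_product] for the preorder and for its opposite gives two surviving products. If both equal
    [e], the support of [b] is squeezed to one point. *)
Lemma two_products (G : groupType) (le : G -> G -> Prop) (v b : groupRing G) e k l :
  (forall h k, le h k \/ le k h) ->
  (forall h k l, le h k -> le k l -> le h l) ->
  (forall h k l, le k l -> le (h * k)%g (h * l)%g) ->
  v != 0 -> {in supp b &, forall k l, le k l -> le l k -> k = l} ->
  k \in supp b -> l \in supp b -> k != l ->
  exists2 h, h \in supp (v * b) & h != e.
Proof.
move=> tot tr mul v0 anti kb lb kl.
have b0 : b != 0 by apply: contraTneq kb => ->; rewrite supp_gcoeff gcoeff0.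
have [h1 [k1 [h1v k1b hk1 k1max max1]]] := max_product tot tr mul v0 b0 anti.
have [h2 [k2 [h2v k2b hk2 k2min min2]]] := @max_product G (fun h k => le k h)
  (fun h k => tot k h) (fun h k l kh lk => tr _ _ _ lk kh)
  (fun h k l => mul h l k) v b v0 b0 (fun k l kb lb kl lk => anti k l kb lb lk kl).
have [e1|] := eqVneq (h1 * k1)%g e; last by exists (h1 * k1)%g.
exists (h2 * k2)%g => //; apply: contraNneq kl => e2.
(* Since [h2 * k1 <= h1 * k1 = e = h2 * k2], left invariance gives [k1 <= k2], while [k1] is
   maximal. *)
have k12 : k1 = k2.
  apply: anti => //; last exact: k1max.
  have : le (h2 * k1)%g (h2 * k2)%g by rewrite e2 -e1; apply: max1.
  by move=> /(mul h2^-1%g); rewrite !mulKg.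
have all_eq m : m \in supp b -> m = k2.
  by move=> mb; apply: anti => //; [rewrite -k12; apply: k1max | apply: k2min].
by apply/eqP; apply: etrans (all_eq _ kb) (esym (all_eq _ lb)).
Qed.

(** * Levels and Fox derivatives *)

Section Levels.
Variables (R : realType) (G : groupType) (phi : G -> R).
Hypothesis phiM : forall h k, phi (h * k)%g = phi h + phi k.
Local Notation ZG := (groupRing G).
Implicit Types (a b c : ZG) (h k : G) (r s : R).

Lemma hom1 : phi 1%g = 0.
Proof. by have := phiM 1%g 1%g; rewrite mulg1; lra. Qed.

Lemma homV h : phi h^-1%g = - phi h.
Proof. by have := phiM h h^-1%g; rewrite mulgV hom1; lra. Qed.

Definition above r c := {in supp c, forall h, r <= phi h}.
Definition strictly_above r c := {in supp c, forall h, r < phi h}.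

Lemma above_le r s c : r <= s -> above s c -> above r c.
Proof. by move=> rs cs h /cs; apply: le_trans. Qed.

Lemma above_strictly r s c : r < s -> above s c -> strictly_above r c.
Proof. by move=> rs cs h /cs; apply: lt_le_trans. Qed.

Lemma above_gelt r h : r <= phi h -> above r (gelt h).
Proof. by move=> rh k; rewrite supp_gelt in_fset1 => /eqP->. Qed.

Lemma aboveN r c : above r c -> above r (- c).
Proof. by move=> cr h; rewrite suppN; apply: cr. Qed.

Lemma aboveD r a b : above r a -> above r b -> above r (a + b).
Proof. by move=> ar br h /suppD[/ar|/br]. Qed.

Lemma aboveB r a b : above r a -> above r b -> above r (a - b).
Proof. by move=> ar br; apply/aboveD/aboveN. Qed.

Lemma above0 r : above r 0.
Proof. by move=> h; rewrite supp_gcoeff gcoeff0. Qed.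

Lemma above1 r : r <= 0 -> above r 1.
Proof. by move=> r0; rewrite -gelt1; apply: above_gelt; rewrite hom1. Qed.

Lemma aboveM r s a b : above r a -> above s b -> above (r + s) (a * b).
Proof.
by move=> ar bs _ /suppM[h [k [/ar rh /bs sk ->]]]; rewrite phiM lerD.
Qed.

Lemma above_gelt_mul r h c : above r c -> above (phi h + r) (gelt h * c).
Proof. by apply: aboveM; apply: above_gelt. Qed.

Lemma strictly_aboveN r c : strictly_above r c -> strictly_above r (- c).
Proof. by move=> cr h; rewrite suppN; apply: cr. Qed.

Lemma strictly_aboveD r a b :
  strictly_above r a -> strictly_above r b -> strictly_above r (a + b).
Proof. by move=> ar br h /suppD[/ar|/br]. Qed.

Lemma strictly_aboveMl r s a b :
  strictly_above r a -> above s b -> strictly_above (r + s) (a * b).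
Proof.
by move=> ar bs _ /suppM[h [k [/ar rh /bs sk ->]]]; rewrite phiM ltr_leD.
Qed.

Lemma strictly_aboveMr r s a b :
  above r a -> strictly_above s b -> strictly_above (r + s) (a * b).
Proof.
by move=> ar bs _ /suppM[h [k [/ar rh /bs sk ->]]]; rewrite phiM ler_ltD.
Qed.

Lemma strictly_above_gap r c :
  strictly_above r c -> exists2 e, 0 < e & above (r + e) c.
Proof.
move=> rc.
suff [e e0 ce] : exists2 e, 0 < e & {in enum_fset (supp c), forall h, r + e <= phi h}.
  by exists e.
have {rc} : {in enum_fset (supp c), forall h, r < phi h} by [].
elim: (enum_fset _) => [|h s IHs] rs; first by exists 1.
have [|e e0 es] := IHs; first by move=> k ks; apply: rs; rewrite in_cons ks orbT.
have rh := rs h (mem_head _ _).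
exists (Num.min e (phi h - r)); first by rewrite lt_min e0 subr_gt0.
move=> k; rewrite in_cons -lerBrDl ge_min => /predU1P[->|/es]; first by rewrite lexx orbT.
by rewrite -lerBrDl => ->.
Qed.

Lemma above_exists c : exists r, above r c.
Proof.
suff [r cr] : exists r, {in enum_fset (supp c), forall h, r <= phi h} by exists r.
elim: (enum_fset _) => [|h s [r sr]]; first by exists 0.
exists (Num.min r (phi h)) => k; rewrite in_cons ge_min => /predU1P[->|/sr->//].
by rewrite lexx orbT.
Qed.

Lemma exists_lowest c : c != 0 -> exists2 k, k \in supp c & above (phi k) c.
Proof.
move=> c0; have ne : enum_fset (supp c) != [::].
  apply: contraNneq c0 => e; apply/eqP/groupRingP => h.
  have no : h \notin enum_fset (supp c) by rewrite e.
  by rewrite gcoeff0; apply: gcoeff_out.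
have [|h k l|k kc kmin] := @exists_max _ (fun h k => phi k <= phi h) _ _ _ ne.
- by move=> h k; case: (leP (phi h) (phi k)) => [|/ltW]; [right|left].
- by move=> kh lk; apply: le_trans lk kh.
- by exists k.
Qed.

Lemma gcoeff_mu a k h : k \in supp a -> above (phi k) a ->
  gcoeff (mu phi a) h = gcoeff a h *+ (phi h == phi k).
Proof.
move=> ka low; rewrite /mu gcoeff_sum.
have allE l : l \in supp a ->
    all (fun i => phi l <= phi i) (supp a) = (phi l == phi k).
  move=> la; apply/allP/eqP => [/(_ k ka) lk|-> //].
  by apply/eqP; rewrite eq_le lk low.
rewrite big_seq_cond (eq_bigl (fun l => (l \in supp a) && (phi l == phi k))); last first.
  by move=> l /=; case: (boolP (l \in supp a)) => // /allE->.
rewrite -big_seq_cond; under eq_bigr => l _ do rewrite gcoeff_gscal.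
have [ha|ha] := boolP (h \in supp a).
  rewrite big_mkcond (bigD1_seq _ ha) ?fset_uniq //= eqxx big1 ?addr0.
    by case: eqP.
  by move=> l /negbTE->; case: ifP.
rewrite (gcoeff_out ha) mul0rn big_seq_cond big1 // => l /andP[la _].
by case: eqP => // e; rewrite -e la in ha.
Qed.

Lemma supp_mu a k h : k \in supp a -> above (phi k) a ->
  (h \in supp (mu phi a)) = (h \in supp a) && (phi h == phi k).
Proof.
move=> ka low; rewrite !supp_gcoeff (gcoeff_mu _ ka low).
by case: (phi h == _); rewrite ?andbT ?andbF.
Qed.

Lemma strictly_above_mu a k : k \in supp a -> above (phi k) a ->
  strictly_above (phi k) (a - mu phi a).
Proof.
move=> ka low h; rewrite supp_gcoeff gcoeffD gcoeffN (gcoeff_mu _ ka low).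
case: (eqVneq (phi h) (phi k)) => [_|ne]; first by rewrite subrr eqxx.
rewrite subr0 -supp_gcoeff => /low.
by rewrite le_eqVlt eq_sym (negbTE ne).
Qed.

Lemma mu_homog a k : k \in supp a -> above (phi k) a ->
  {in supp (mu phi a), forall h, phi h = phi k}.
Proof. by move=> ka low h; rewrite (supp_mu _ ka low) => /andP[_ /eqP]. Qed.

(* If [h] is at the lowest level in the support of [c], the coefficient of
   [c * (x - 1)] at [h] is minus that of [c]. *)
Lemma above_div x r c : 0 < phi x -> above r (c * (gelt x - 1)) -> above r c.
Proof.
move=> x0 cr; have [->|c0] := eqVneq c 0; first exact: above0.
have [k kc low] := exists_lowest c0.
apply: (above_le _ low); rewrite leNgt; apply/negP => kr.
have : k \notin supp (c * (gelt x - 1)) by apply: contraL kr => /cr; rewrite leNgt.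
rewrite mulrBr mulr1 supp_gcoeff gcoeffD gcoeffN gcoeffM_gelt.
rewrite gcoeff_out; last by apply/negP => /low; rewrite phiM homV; lra.
by rewrite add0r oppr_eq0 -supp_gcoeff kc.
Qed.

End Levels.

(** An occurrence of [s] after the prefix [p] contributes [p], and an occurrence of [s^-1]
    contributes [- p s^-1]. Hence the empty prefix can only come from an initial letter [s]. *)
Lemma fox_word_supp (T : choiceType) (s : T) (w : seq (letter T)) p :
  reduced w -> p \in supp (fox_word s w) ->
  prefix (fword p) w /\ (fword p = [::] -> prefix [:: (s, false)] w).
Proof.
elim: w p => [|l w IHw] p rw; first by rewrite supp_gcoeff gcoeff0.
case/suppD; last first.
  case/suppM => h [q [+ /(IHw _ (reduced_behead rw))[/prefixP[w' ew] _] ep]].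
  rewrite supp_gelt in_fset1 => /eqP eh.
  have -> : fword p = l :: fword q.
    rewrite ep eh /=; apply: lact_cons.
    by move: rw; rewrite /reduced ew -cat_cons => /cat_sorted2[].
  by rewrite /= eqxx ew prefix_prefix.
rewrite /fox_letter; case: l rw => r b rw /=.
case: eqP => [->|_]; last by rewrite supp_gcoeff gcoeff0.
case: b {rw}; rewrite ?suppN -?gelt1 supp_gelt in_fset1 => /eqP->.
  by rewrite /= eqxx prefix0s.
by rewrite /= eqxx !prefix0s.
Qed.

Section FoxPush.
Variables (T : choiceType) (G : groupType) (f : {multiplicative freeGroup T -> G}).

Definition dfox (s : T) (w : freeGroup T) : groupRing G :=
  gring_map f (fox s (gelt w)).

Lemma gring_map0 (H : groupType) (k : H -> G) : gring_map k 0 = 0.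
Proof. by have := gring_mapB k 0 0; rewrite !subrr. Qed.

Lemma gring_mapN (H : groupType) (k : H -> G) a : gring_map k (- a) = - gring_map k a.
Proof. by have := gring_mapB k 0 a; rewrite gring_map0 !sub0r. Qed.

Lemma gring_mapD (H : groupType) (k : H -> G) a b :
  gring_map k (a + b) = gring_map k a + gring_map k b.
Proof. by have := gring_mapB k a (- b); rewrite gring_mapN !opprK. Qed.

Lemma dfox1 s : dfox s 1%g = 0.
Proof. by rewrite /dfox fox1; apply: gring_map0. Qed.

Lemma dfoxM s u v : dfox s (u * v)%g = dfox s u + gelt (f u) * dfox s v.
Proof. by rewrite /dfox foxM gring_mapD gring_mapM gring_map_gelt. Qed.

Lemma dfoxV s u : dfox s u^-1%g = - (gelt (f u)^-1%g * dfox s u).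
Proof.
have := dfoxM s u^-1%g u; rewrite mulVg dfox1 multV => /esym e.
by apply/eqP; rewrite -addr_eq0 e.
Qed.

Lemma dfox_gen s r : dfox s (fgen r) = (r == s)%:R.
Proof.
rewrite /dfox fox_gen; case: (r == s); last exact: gring_map0.
by have := gring_map_gelt f 1%g; rewrite mult1.
Qed.

End FoxPush.

Section FundamentalStep.
Variables (A : pzRingType) (x y : A).

Lemma fundamental_mul (u v p q p' q' : A) :
  u - 1 = p * x + q * y -> v - 1 = p' * x + q' * y ->
  u * v - 1 = (p + u * p') * x + (q + u * q') * y.
Proof.
move=> eu ev; rewrite !mulrDl -!mulrA addrACA -eu -mulrDr -ev mulrBr mulr1.
by rewrite [RHS]addrC addrA subrK.
Qed.

Lemma fundamental_inv (u v p q : A) :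
  v * u = 1 -> u - 1 = p * x + q * y ->
  v - 1 = - (v * p) * x + - (v * q) * y.
Proof.
move=> vu eu; rewrite !mulNr -opprD -!mulrA -mulrDr -eu mulrBr mulr1 vu.
by rewrite opprB.
Qed.

End FundamentalStep.

(** The fundamental formula of Fox calculus: both sides obey the same product rule and agree on the
    generators. *)
Lemma dfox_fundamental (G : groupType) (f : {multiplicative F2 -> G}) (w : F2) :
  gelt (f w) - 1 = dfox f ix w * (gelt (f (fgen ix)) - 1)
                 + dfox f iy w * (gelt (f (fgen iy)) - 1).
Proof.
elim/freeGroup_ind: w => [|s|u v eu ev|u eu].
- by rewrite !dfox1 !mul0r addr0 mult1 gelt1 subrr.
- rewrite !dfox_gen; case: (eqVneq s ix) => [->|sx].
    by rewrite mul1r mul0r addr0.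
  have -> : s = iy by apply/val_inj; case: s sx => -[|[|//]] //= i.
  by rewrite mul1r mul0r add0r.
- rewrite !dfoxM gmulfM geltM; exact: fundamental_mul eu ev.
rewrite !dfoxV multV; apply: fundamental_inv eu.
by rewrite -geltM mulVg gelt1.
Qed.

(** * Pushing chains up *)

Section FilteredRing.
(** [F r a] is to be read as: all terms of [a] have level at least [r]. It is instantiated with
    [above phi] on the group ring. *)
Variables (R : realType) (A : pzRingType) (F : R -> A -> Prop).
Hypothesis F_le : forall r s a, r <= s -> F s a -> F r a.
Hypothesis FD : forall r a b, F r a -> F r b -> F r (a + b).
Hypothesis FN : forall r a, F r a -> F r (- a).
Hypothesis FM : forall r s a b, F r a -> F s b -> F (r + s) (a * b).
Hypothesis F1 : F 0 1.

Definition geom (h : A) n : A := \sum_(i < n) h ^+ i.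

(** The equation is substituted [n] times into its own term [h * u]. *)
Lemma geom_relation (h u p v q w : A) n :
  u = h * u + p * v + q * w ->
  u = h ^+ n * u + geom h n * p * v + geom h n * q * w.
Proof.
move=> e; rewrite /geom; elim: n => [|n IHn].
  by rewrite big_ord0 expr0 !mul0r mul1r !addr0.
rewrite big_ord_recr /= {1}IHn {1}e exprSr !mulrDl !mulrDr !mulrA -!addrA.
congr (_ + _); rewrite [RHS]addrCA; congr (_ + _).
by rewrite addrC -addrA.
Qed.

Lemma F_pow r h n : F r h -> F (r *+ n) (h ^+ n).
Proof.
by move=> Fh; elim: n => [|n IHn]; rewrite ?expr0 ?mulr0n // exprS mulrS; apply: FM.
Qed.

Lemma F_zero r a : F r a -> F r 0.
Proof. by move=> Fa; rewrite -(subrr a); apply/FD/FN. Qed.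

Lemma F_geom h n : F 0 h -> F 0 (geom h n).
Proof.
move=> Fh; rewrite /geom; elim/big_ind: _ => [||i _].
- exact: F_zero F1.
- exact: FD.
- by have := F_pow i Fh; rewrite mul0rn.
Qed.

Lemma F_geom_sub1 r h n : 0 <= r -> F r h -> F r (geom h n.+1 - 1).
Proof.
move=> r0 Fh; rewrite /geom big_ord_recl /= expr0 addrAC subrr add0r.
elim/big_ind: _ => [||i _]; [exact: F_zero Fh | exact: FD |].
rewrite exprS -[r]addr0; apply: FM => //.
by have := F_pow i (F_le r0 Fh); rewrite mul0rn.
Qed.

(** Differentiating both sides of [S * T = T * gS] gives [(S - 1) + S * (T - 1) = (T - 1) + T * (gS
    - 1)]. *)
Lemma hnn_relation (S T gS p q v : A) :
  S * T = T * gS -> gS - 1 = p * (S - 1) + q * v ->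
  T - 1 = S * (T - 1) + (1 - T * p) * (S - 1) + - (T * q) * v.
Proof.
move=> ST gS_fox; rewrite mulrBl mul1r mulNr -!addrA -opprD.
rewrite -!mulrA -mulrDr -gS_fox !mulrBr !mulr1 ST opprB.
by rewrite addrA subrK [RHS]addrCA (addrC T (- (T * gS))) addNKr addrC.
Qed.

Variables (X Y T Ax Ay Bx By gX gY : A).
Hypotheses (XT : X * T = T * gX) (YT : Y * T = T * gY).
Hypotheses (gX_fox : gX - 1 = Ax * (X - 1) + Ay * (Y - 1))
           (gY_fox : gY - 1 = By * (Y - 1) + Bx * (X - 1)).

Lemma eliminate_stable n :
  T - 1 = X ^+ n * (T - 1) + geom X n * (1 - T * Ax) * (X - 1)
        + geom X n * - (T * Ay) * (Y - 1).
Proof. exact: geom_relation (hnn_relation XT gX_fox). Qed.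

(** The coefficient on the left is [1 - T * By - (Y - 1) * geom X n * (T * Ay)], written as a
    correction of [1 + T * Ay - T * By]. For [n > 0] the factor [1 + (Y - 1) * geom X n = Y * geom X
    n - (geom X n - 1)] has positive level, so the leading term is unchanged. *)
Lemma eliminate_relation n :
  (1 + T * Ay - T * By - (1 + (Y - 1) * geom X n) * (T * Ay)) * (Y - 1) =
  (T * Bx - (Y - 1) * (geom X n * (1 - T * Ax))) * (X - 1)
  - (Y - 1) * X ^+ n * (T - 1).
Proof.
(* Here [Y] plays the part of [S], which is why [gY_fox] lists its [Y - 1] term first. *)
have eY := hnn_relation YT gY_fox; set u := T - 1 in eY *.
set v := Y - 1 in eY *; set w := X - 1 in eY *.
have eV : (1 - T * By) * v = T * Bx * w - v * u.
  rewrite [v * u]mulrBl mul1r; set b := _ * v; set c := _ * w.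
  rewrite [X in _ - (_ - X)]eY mulNr -/b -/c opprB.
  by rewrite -[_ + b - c]addrA [_ + (b - c)]addrC addrK addrC subrK.
have -> : 1 + T * Ay - T * By - (1 + v * geom X n) * (T * Ay)
    = 1 - T * By - v * (geom X n * (T * Ay)).
  rewrite mulrDl mul1r -mulrA opprD addrA; congr (_ - _).
  by rewrite addrAC addrK.
have eX := eliminate_stable n; rewrite -/u -/v -/w in eX.
clearbody u v w; clear eY; rewrite mulrBl eV [X in _ = X - _]mulrBl.
rewrite -[LHS]addrA -[RHS]addrA.
congr (_ + _); move: (1 - T * Ax) eX => P0 eX.
rewrite [X in v * X]eX !mulrDr !mulrN mulNr mulrN !mulrA.
rewrite opprB addrAC subrr sub0r opprD; exact: addrC.
Qed.

(** [e] stands for the leading term, [ze] for its level and [e'] for its inverse. The gap [ep]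
    bounds from below the levels of [X] and [Y] and the distance from [ze] to the other terms. *)
Variables (e e' : A) (ze ep : R).
Hypotheses (ep_gt0 : 0 < ep) (FX : F ep X) (FY : F ep Y).
Hypotheses (e'e : e' * e = 1) (Fe' : F (- ze) e') (FTA : F ze (T * Ay)).
Hypothesis Flead : F (ze + ep) (1 + T * Ay - T * By - e).
Hypothesis F_ex : forall a, exists r, F r a.

Lemma multiple_ge M : exists n, M <= ep *+ n.
Proof.
exists (Num.bound (`|M| / ep)); rewrite -mulr_natl -ler_pdivrMr //.
apply: le_trans (ltW (archi_boundP _)); last by rewrite divr_ge0 // ltW.
by rewrite ler_pM2r ?invr_gt0 // ler_norm.
Qed.

(* The leading term [e] of the coefficient of [Y - 1] in [eliminate_relation]
   is invertible, so that [Y - 1] is rewritten with coefficients of arbitrarily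
   high level on [Y - 1] and [T - 1]. *)
Lemma push_up N : exists P Q C,
  [/\ F N P, F N C & Y - 1 = P * (Y - 1) + Q * (X - 1) + C * (T - 1)].
Proof.
have FY0 : F 0 Y by apply: F_le FY; apply: ltW.
(* [n] makes [X ^+ n.+1] high enough to have level [N] even after multiplication by [e']; [k] counts
   the iterations that raise the coefficient of [Y - 1] from level [ep] to [N]. The exponent [n.+1]
   is positive, as [F_geom_sub1] requires. *)
have [n Nn] := multiple_ge (ze + N); have [k Nk] := multiple_ge N.
have := eliminate_relation n.+1; set q := geom X n.+1.
set rho := 1 + T * Ay - T * By - _; set ga := _ - _ * (_ * _).
set v := Y - 1; set u := T - 1; set w := X - 1 => rel.
(* [e - rho] consists of the terms above the leading one and of [(1 + v * q) * (T * Ay)], both of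
   level at least [ze + ep]. *)
have Feta : F ep (e' * (e - rho)).
  have -> : ep = - ze + (ze + ep) by rewrite addKr.
  apply: FM => //; rewrite /rho opprB addrA addrAC -opprB addrC.
  apply: FD; last exact: FN.
  rewrite addrC; apply: FM; last exact: FTA.
  rewrite /v mulrBl mul1r addrCA -opprB; apply: FD; last first.
    by apply/FN/F_geom_sub1 => //; apply: ltW.
  rewrite -[ep]addr0; apply: FM => //.
  by apply: F_geom; apply: F_le FX; apply: ltW.
(* Write [v = e' * (e - rho) * v + e' * (rho * v)] and replace [rho * v] by means of [rel]. *)
have step : v = e' * (e - rho) * v + e' * ga * w + - (e' * (v * X ^+ n.+1)) * u.
  rewrite mulrBr mulrBl e'e mul1r mulNr -!mulrA -addrA -mulrBr.
  by rewrite (mulrA v) -rel subrK.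
have := geom_relation k step.
set C := geom _ _ * - _ => eq_v.
exists ((e' * (e - rho)) ^+ k), (geom (e' * (e - rho)) k * (e' * ga)), C.
split=> //; first by apply: F_le Nk _; apply: F_pow.
rewrite /C -[N]add0r; apply: FM.
  by apply: F_geom; apply: F_le Feta; apply: ltW.
apply: FN; have -> : N = - ze + (0 + (ze + N)) by rewrite add0r addKr.
apply: FM => //; apply: FM; first by apply: FD => //; apply: FN.
apply: (F_le (s := ep *+ n.+1)); last exact: F_pow.
by rewrite mulrS (le_trans Nn) // lerDr ltW.
Qed.

(** [T - 1] is raised first, at the cost of a new coefficient of [Y - 1], which [push_up] then
    raises. The coefficient of [X - 1] is left free; [above_div] recovers its level from the
    boundary. *)
Lemma push_up_combination N cx cy ct : exists cx' cy' ct',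
  [/\ F N cy', F N ct' & cx * (X - 1) + cy * (Y - 1) + ct * (T - 1)
                        = cx' * (X - 1) + cy' * (Y - 1) + ct' * (T - 1)].
Proof.
have [r Fct] := F_ex ct; have [n Nn] := multiple_ge (N - r).
have := eliminate_stable n; set p := geom _ _ * _; set q := geom _ _ * _.
set u := T - 1; set v := Y - 1; set w := X - 1 => eu.
have [s Fs] := F_ex (cy + ct * q).
have [P [Q [C [FP FC ev]]]] := push_up (N - s); rewrite -/u -/v -/w in ev.
exists (cx + ct * p + (cy + ct * q) * Q), ((cy + ct * q) * P),
  (ct * X ^+ n + (cy + ct * q) * C); split.
- by have := FM Fs FP; rewrite addrC subrK.
- apply: FD; last by have := FM Fs FC; rewrite addrC subrK.
  apply: F_le (FM Fct (F_pow n FX)); by rewrite -lerBlDl.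
clearbody u v w p q; set d := cy + ct * q.
have ed : cy * v + ct * q * v = d * v by rewrite -mulrDl.
rewrite [X in ct * X]eu !mulrDr !mulrA (AC (2*3) ((1*4)*(2*5)*3)) /=.
rewrite ed; clearbody d; clear ed; rewrite {1}ev !mulrDr !mulrDl !mulrA.
by rewrite (AC (2*3*1) ((1*2*4)*3*(6*5))).
Qed.

End FilteredRing.

Section Combinations.
Variables (A : pzRingType) (X Y T : A).

(** The left ideal generated by [X - 1], [Y - 1] and [T - 1], that is, the boundaries of chains in
    the Cayley graph. *)
Definition combination p := exists cx cy ct,
  p = cx * (X - 1) + cy * (Y - 1) + ct * (T - 1).

Lemma combinationB p q : combination p -> combination q -> combination (p - q).
Proof.
move=> [a [b [c ->]]] [a' [b' [c' ->]]]; exists (a - a'), (b - b'), (c - c').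
by rewrite !mulrBl; rewrite !opprD addrACA; congr (_ + _); rewrite addrACA.
Qed.

Lemma combinationM r p : combination p -> combination (r * p).
Proof.
by move=> [a [b [c ->]]]; exists (r * a), (r * b), (r * c); rewrite !mulrDr !mulrA.
Qed.

Lemma combination0 : combination 0.
Proof. by exists 0, 0, 0; rewrite !mul0r !addr0. Qed.

Lemma combination_mul u v :
  combination (u - 1) -> combination (v - 1) -> combination (u * v - 1).
Proof.
move=> cu cv; have -> : u * v - 1 = (u - 1) - - (u * (v - 1)).
  by rewrite mulrBr mulr1 opprK [RHS]addrC addrA subrK.
apply: combinationB cu _; rewrite -sub0r.
exact: combinationB combination0 (combinationM u cv).
Qed.

Lemma combination_inv u v :
  v * u = 1 -> combination (u - 1) -> combination (v - 1).
Proof.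
move=> vu cu; have -> : v - 1 = 0 - v * (u - 1).
  by rewrite mulrBr mulr1 vu sub0r opprB.
exact: combinationB combination0 (combinationM v cu).
Qed.

Lemma combination_gens :
  [/\ combination (X - 1), combination (Y - 1) & combination (T - 1)].
Proof.
split; [exists 1, 0, 0 | exists 0, 1, 0 | exists 0, 0, 1];
by rewrite !mul0r mul1r ?add0r ?addr0.
Qed.

End Combinations.

(** * Connectedness of half spaces from chains *)

Section CayleyConnected.
Variables (R : realType) (G : groupType) (phi : G -> R).
Hypothesis phiM : forall h k, phi (h * k)%g = phi h + phi k.
Hypothesis phi_neq0 : exists h, phi h != 0.
Variable S : seq G.
Hypothesis S_gen : generated [set s | s \in S]%classic = [set: G]%classic.

Lemma gen_ind (P : G -> Prop) : P 1%g ->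
  (forall h k, P h -> P k -> P (h * k)%g) -> (forall h, P h -> P h^-1%g) ->
  {in S, forall s, P s} -> forall h, P h.
Proof.
move=> P1 PM PV PS h.
have : generated [set s | s \in S]%classic h by rewrite S_gen.
by move=> /(_ P); apply; [split | move=> s; apply: PS].
Qed.

Lemma positive_letter : exists2 s, 0 < phi s & s \in S \/ s^-1%g \in S.
Proof.
have [|no] := pselect (exists2 s, s \in S & phi s != 0).
  move=> [s sS]; rewrite neq_lt => /orP[neg|pos]; last by exists s => //; left.
  by exists s^-1%g; [rewrite (homV phiM) oppr_gt0 | right; rewrite invgK].
have [h /eqP[]] := phi_neq0; move: h; apply: gen_ind.
- exact: hom1.
- by move=> h k eh ek; rewrite phiM eh ek addr0.
- by move=> h eh; rewrite (homV phiM) eh oppr0.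
- move=> s sS; apply: contrapT => /eqP ne; apply: no; by exists s.
Qed.

Section LocallyConstant.
Variable f : G -> int.
Hypothesis f_step : forall h s, s \in S -> 0 <= phi h -> 0 <= phi (h * s)%g ->
  f (h * s)%g = f h.

Lemma f_letter h s : s \in S \/ s^-1%g \in S ->
  0 <= phi h -> 0 <= phi (h * s)%g -> f (h * s)%g = f h.
Proof.
move=> [sS|sS] h0 hs0; first exact: f_step.
by have := @f_step (h * s)%g _ sS hs0; rewrite mulgK => ->.
Qed.

(** A word for [w] in the letters of [S], read from a sufficiently high vertex, stays in the half
    space, and [f] is constant along it. *)
Lemma locally_constant_far w : exists D, forall h, D <= phi h -> f (h * w)%g = f h.
Proof.
move: w; apply: gen_ind => [|v w [D fv] [E fw]|w [D fw]|s sS].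
- by exists 0 => h _; rewrite mulg1.
- exists (Num.max D (E - phi v)) => h; rewrite ge_max lerBlDr => /andP[Dh Eh].
  by rewrite mulgA fw ?fv // phiM.
- exists (D + phi w) => h Dh; have := fw (h * w^-1)%g.
  by rewrite mulgVK phiM (homV phiM) lerBrDr => ->.
- exists `|phi s| => h sh; apply: f_letter; [by left | exact: le_trans sh |].
  rewrite phiM; have := ler_norm (- phi s); rewrite normrN; lra.
Qed.

Lemma f_ray s n h : s \in S \/ s^-1%g \in S -> 0 <= phi s -> 0 <= phi h ->
  f (h * s ^+ n)%g = f h /\ phi (h * s ^+ n)%g = phi h + phi s *+ n.
Proof.
move=> sS s0 h0; elim: n => [|n [ef ep]]; first by rewrite expg0 mulg1 mulr0n addr0.
rewrite expgSr mulgA; split; last by rewrite phiM ep mulrSr addrA.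
have hn0 : 0 <= phi (h * s ^+ n)%g by rewrite ep addr_ge0 ?mulrn_wge0.
by rewrite f_letter // phiM addr_ge0.
Qed.

Lemma zlin_boundary D w (c : groupRing G) :
  (forall h, D <= phi h -> f (h * w)%g = f h) -> above phi D c ->
  zlin f (c * (gelt w - 1)) = 0.
Proof.
move=> fw Dc; rewrite [c]groupRingE mulr_suml raddf_sum big_seq big1 // => h hc.
rewrite gscalE mulrzAl raddfMz mulrBr mulr1 -geltM raddfB /= !zlin_gelt fw.
  by rewrite subrr mul0rz.
exact: Dc.
Qed.

End LocallyConstant.

(* The indicator function of a component is locally constant, hence its linear
   extension vanishes on boundaries of chains far up. *)
Lemma connected_of_chains (x y t : G) :
  (forall N h k, N <= phi h -> N <= phi k -> exists cx cy ct,
    [/\ above phi N cx, above phi N cy, above phi N ct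
      & gelt h - gelt k = cx * (gelt x - 1) + cy * (gelt y - 1) + ct * (gelt t - 1)]) ->
  full_connected (cayley S) (fun h => 0 <= - phi h).
Proof.
move=> chains h0 k0 Vh Vk; pose V h : bool := 0 <= - phi h.
pose conn k := exists p, [/\ path (cayley S) h0 p, all V p & last h0 p = k].
(* Inversion turns the edges from [h] to [s * h] into right multiplications, which match left chains
   over ZG, and the half space of [- phi] into that of [phi]. *)
pose f (h : G) : int := (asbool (conn h^-1%g))%:R.
have conn_step h k : cayley S h k -> V k -> conn h -> conn k.
  move=> hk kV [p [pp pV pl]]; exists (rcons p k); split.
  - by rewrite rcons_path pp pl.
  - by rewrite all_rcons kV.
  - by rewrite last_rcons.
have f_step h s : s \in S -> 0 <= phi h -> 0 <= phi (h * s)%g -> f (h * s)%g = f h.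
  move=> sS h0' hs0; congr (_%:R); congr nat_of_bool; apply/asbool_equiv_eq.
  have e1 : cayley S (h * s)^-1%g h^-1%g.
    by apply/hasP; exists s => //; rewrite invgM mulVKg eqxx.
  have e2 : cayley S h^-1%g (h * s)^-1%g.
    by apply/hasP; exists s => //; rewrite invgM mulVKg eqxx orbT.
  by split; apply: conn_step => //; rewrite /V (homV phiM) opprK.
have [[Dx fx] [Dy fy] [Dt ft]] := And3 (locally_constant_far f_step x)
  (locally_constant_far f_step y) (locally_constant_far f_step t).
pose D := Num.max Dx (Num.max Dy Dt).
have [s s0 sS] := positive_letter.
have phih : 0 <= phi h0^-1%g by rewrite (homV phiM).
have phik : 0 <= phi k0^-1%g by rewrite (homV phiM).
(* Both endpoints are moved along the positive letter [s] up to level [D], where boundaries are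
   killed by [f]. *)
have [n Dn] := multiple_ge s0 D.
have [fh ph] := f_ray f_step n sS (ltW s0) phih.
have [fk pk] := f_ray f_step n sS (ltW s0) phik.
have [||cx [cy [ct [ax ay atT e]]]] := chains D (h0^-1 * s ^+ n)%g (k0^-1 * s ^+ n)%g.
- by rewrite ph (le_trans Dn) // lerDr.
- by rewrite pk (le_trans Dn) // lerDr.
have : f h0^-1%g - f k0^-1%g = 0.
  rewrite -fh -fk -!(zlin_gelt f) -raddfB e !raddfD /=.
  rewrite (zlin_boundary fx) ?(zlin_boundary fy) ?(zlin_boundary ft) ?addr0 //.
  - by apply: above_le atT; rewrite /D !le_max lexx !orbT.
  - by apply: above_le ay; rewrite /D !le_max lexx !orbT.
  - by apply: above_le ax; rewrite /D le_max lexx.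
rewrite /f !invgK asboolT; last by exists [::].
case: (asboolP (conn k0)) => [//|_]; by rewrite subr0.
Qed.

End CayleyConnected.

(** At each group element at most one of the three summands has a nonzero coefficient, so nothing
    cancels. *)
Lemma supp_stable_combination (G : groupType) (A B : groupRing G) (t : G) :
  {in supp A, forall k, (t * k)%g <> 1%g} ->
  {in supp B, forall k, (t * k)%g <> 1%g} ->
  (forall k, k \in supp A -> k \in supp B -> False) ->
  let a : groupRing G := 1 + gelt t * A - gelt t * B in
  [/\ 1%g \in supp a, {subset supp (gelt t * A) <= supp a},
      {subset supp (gelt t * B) <= supp a}
    & forall h, h \in supp a ->
      h = 1%g \/ exists2 k, k \in supp A \/ k \in supp B & h = (t * k)%g].
Proof.
move=> tA tB AB a.
have aE h : gcoeff a h =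
    (1%g == h)%:R + gcoeff A (t^-1 * h)%g - gcoeff B (t^-1 * h)%g.
  by rewrite /a gcoeffD gcoeffN gcoeffD gcoeff_gelt !gcoeff_geltM.
have neq1 h : (t^-1 * h)%g \in supp A \/ (t^-1 * h)%g \in supp B -> (1%g == h) = false.
  by case=> [/tA|/tB]; rewrite mulVKg => ne; apply/negP => /eqP /esym.
split.
- rewrite supp_gcoeff aE (eqxx 1%g) !gcoeff_out //; apply/negP => H.
    by have := neq1 1%g (or_intror H); rewrite eqxx.
  by have := neq1 1%g (or_introl H); rewrite eqxx.
- move=> h; rewrite supp_gcoeff gcoeff_geltM -supp_gcoeff => hA.
  rewrite supp_gcoeff aE neq1; last by left.
  rewrite add0r [X in _ - X]gcoeff_out ?subr0 -?supp_gcoeff //.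
  exact/negP/(AB _ hA).
- move=> h; rewrite supp_gcoeff gcoeff_geltM -supp_gcoeff => hB.
  rewrite supp_gcoeff aE neq1; last by right.
  rewrite add0r [X in X - _]gcoeff_out ?sub0r ?oppr_eq0 -?supp_gcoeff //.
  by apply/negP => hA; apply: AB hA hB.
move=> h; rewrite /a => /suppD[/suppD[|]|].
- by rewrite -gelt1 supp_gelt in_fset1 => /eqP; left.
- move=> /suppM[k [l [+ lA ->]]]; rewrite supp_gelt in_fset1 => /eqP->.
  by right; exists l => //; left.
rewrite suppN => /suppM[k [l [+ lB ->]]]; rewrite supp_gelt in_fset1 => /eqP->.
by right; exists l => //; right.
Qed.

Lemma addr3_eq (V : zmodType) (p a b c : V) : p = a + b + c -> a = p - b - c.
Proof. by move=> ->; rewrite addrAC addrK addrK. Qed.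

Section MonomialChains.
Variables (R : realType) (G : groupType) (phi : G -> R).
Hypothesis phiM : forall h k, phi (h * k)%g = phi h + phi k.
Variables (x y t gx gy : G) (Ax Ay Bx By : groupRing G).
Hypotheses (xt : (x * t = t * gx)%g) (yt : (y * t = t * gy)%g).
Hypothesis gx_fox : gelt gx - 1 = Ax * (gelt x - 1) + Ay * (gelt y - 1).
Hypothesis gy_fox : gelt gy - 1 = Bx * (gelt x - 1) + By * (gelt y - 1).
Hypotheses (phi_x : 0 < phi x) (phi_y : 0 < phi y).
Hypothesis generators : forall h, combination (gelt x) (gelt y) (gelt t) (gelt h - 1).

Lemma chains_of_monomial (z : G) (e e' : groupRing G) N h k :
  let a := 1 + gelt t * Ay - gelt t * By in
  e' * e = 1 -> above phi (- phi z) e' ->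
  strictly_above phi (phi z) (a - e) -> above phi (phi z) (gelt t * Ay) ->
  N <= phi h -> N <= phi k -> exists cx cy ct,
    [/\ above phi N cx, above phi N cy, above phi N ct
      & gelt h - gelt k = cx * (gelt x - 1) + cy * (gelt y - 1) + ct * (gelt t - 1)].
Proof.
move=> a e'e Fe' lead FTA Nh Nk.
have [ep0 ep0_gt0 Flead0] := strictly_above_gap lead.
pose ep := Num.min ep0 (Num.min (phi x) (phi y)).
have ep_gt0 : 0 < ep by rewrite !lt_min ep0_gt0 phi_x.
have Flead : above phi (phi z + ep) (a - e).
  by apply: above_le Flead0; rewrite lerD2l ge_min lexx.
have FX : above phi ep (gelt x) by apply: above_gelt; rewrite !ge_min lexx orbT.
have FY : above phi ep (gelt y) by apply: above_gelt; rewrite !ge_min lexx !orbT.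
have XT : gelt x * gelt t = gelt t * gelt gx by rewrite -!geltM xt.
have YT : gelt y * gelt t = gelt t * gelt gy by rewrite -!geltM yt.
have gy_fox' := etrans gy_fox (addrC _ _).
have : combination (gelt x) (gelt y) (gelt t) (gelt h - gelt k).
  have -> : gelt h - gelt k = (gelt h - 1) - (gelt k - 1).
    by rewrite opprB addrA subrK.
  exact: combinationB (generators h) (generators k).
move=> [cx [cy [ct e0]]].
(* The margin [|phi t|] is kept because [phi t] may have either sign, so that multiplication by
   [t - 1] can lower levels by that much. *)
have [cx' [cy' [ct' [Fcy Fct e1]]]] := push_up_combination
  (@above_le R G phi) (@aboveD R G phi) (@aboveN R G phi) (aboveM phiM)
  (above1 phiM (lexx 0)) XT YT gx_fox gy_fox' ep_gt0 FX FY e'e Fe' FTA Flead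
  (above_exists phi) (N + `|phi t|) cx cy ct.
have e2 := etrans e0 e1; exists cx', cy', ct'; split; last exact: e2.
(* The remaining terms of the boundary equation have level [N], hence so has [cx' * (x - 1)], and
   then [cx']. *)
- apply: (above_div phiM phi_x); rewrite (addr3_eq e2).
  apply: aboveB; first apply: aboveB.
  + by apply: aboveB; apply: above_gelt.
  + rewrite -[N]addr0; apply: aboveM => //.
      by apply: above_le Fcy; rewrite lerDl.
    apply: aboveB; last exact: above1.
    by apply: above_gelt; apply: ltW.
  + have -> : N = (N + `|phi t|) - `|phi t| by rewrite addrK.
    apply: aboveM => //; apply: aboveB; last by apply: above1; rewrite // oppr_le0.
    by apply: above_gelt; rewrite lerNl -normrN ler_norm.
- by apply: above_le Fcy; rewrite lerDl.
- by apply: above_le Fct; rewrite lerDl.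
Qed.

End MonomialChains.

(** * Leading terms of relations *)

Section RelationAlgebra.
Variable A : pzRingType.
Implicit Types (p q r u v x y : A).

Lemma sum_of_relation x y u v r :
  u * (x - 1) + v * (y - 1) = r -> u + v = u * x + v * y - r.
Proof.
by move=> <-; rewrite !mulrBr !mulr1 addrACA -opprD subKr.
Qed.

Lemma relation_regroup p q u v :
  v * (1 + p - q) + 1 = (v * (1 - q) - u * p + 1) + (u + v) * p.
Proof.
rewrite [RHS]addrAC; congr (_ + _); rewrite mulrDl addrA subrK.
by rewrite -mulrDr addrAC.
Qed.

Lemma leading_product u v p q : u * v + 1 =
  p * q + 1 + p * (v - q) + (u - p) * v.
Proof.
rewrite mulrBr mulrBl [X in _ = X + _]addrC [X in _ = X + _]addrA subrK.
by rewrite [RHS]addrC addrA subrK.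
Qed.

End RelationAlgebra.

Section LeadingMonomial.
Variables (R : realType) (G : groupType) (phi : G -> R).
Hypothesis phiM : forall h k, phi (h * k)%g = phi h + phi k.
Local Notation ZG := (groupRing G).

Lemma not_above1 r : 0 < r -> ~ above phi r (1 : ZG).
Proof.
move=> r0 /(_ 1%g); rewrite -gelt1 supp_gelt in_fset1 eqxx (hom1 phiM) => /(_ isT).
by rewrite leNgt r0.
Qed.

Variable le : G -> G -> Prop.
Hypothesis le_total : forall h k, le h k \/ le k h.
Hypothesis le_trans : forall h k l, le h k -> le k l -> le h l.
Hypothesis le_mul : forall h k l, le k l -> le (h * k)%g (h * l)%g.

(** All of [v * b] lies at level [l + m], where [v * b + 1] has no terms, so its support is
    contained in [1]. By [two_products], [b] then has a single term, whose coefficient divides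
    [-1]. *)
Lemma monomial_of_leading_inverse (v b : ZG) (l m : R) k0 :
  v != 0 -> k0 \in supp b ->
  {in supp v, forall h, phi h = l} -> {in supp b, forall h, phi h = m} ->
  {in supp b &, forall h k, le h k -> le k h -> h = k} ->
  strictly_above phi (l + m) (v * b + 1) ->
  b = gelt k0 \/ b = - gelt k0.
Proof.
move=> v0 k0b vl bm anti lead.
have supp1 h : h \in supp (v * b) -> h = 1%g /\ gcoeff (v * b) 1%g = -1.
  move=> hvb; have phih : phi h = l + m.
    by have [i [j [/vl iv /bm jb ->]]] := suppM hvb; rewrite phiM iv jb.
  have : gcoeff (v * b + 1) h = 0.
    by apply: gcoeff_out; apply/negP => /lead; rewrite phih ltxx.
  rewrite gcoeffD -gelt1 gcoeff_gelt; have [<-|ne] := eqVneq 1%g h.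
    by move=> /eqP; rewrite addr_eq0 => /eqP.
  by rewrite addr0 => e; rewrite supp_gcoeff e eqxx in hvb.
have b1 k : k \in supp b -> k = k0.
  move=> kb; have [//|ne] := eqVneq k k0.
  have [h /supp1[-> _]] := two_products 1%g le_total le_trans le_mul v0 anti kb k0b ne.
  by rewrite eqxx.
have bE h : gcoeff b h = gcoeff b k0 *+ (k0 == h).
  have [<-//|ne] := eqVneq k0 h; apply: gcoeff_out; apply/negP => /b1 e.
  by rewrite e eqxx in ne.
have [k kv _] := @exists_lowest _ _ phi _ v0.
have vbE : gcoeff (v * b) (k * k0)%g = gcoeff v k * gcoeff b k0.
  rewrite gcoeffM (bigD1_seq _ kv) ?fset_uniq //= mulKg big1_seq ?addr0 //.
  move=> i /andP[ne _]; rewrite bE; case: eqP => [e|]; last by rewrite mulr0n mulr0.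
  by move/eqP: ne; case; apply: (mulIg k0); rewrite [in LHS]e mulVKg.
have k0' : gcoeff v k * gcoeff b k0 = -1.
  have [] := supp1 (k * k0)%g.
    by rewrite supp_gcoeff vbE mulf_neq0 // -supp_gcoeff.
  by move=> <- <-.
have : absz (gcoeff b k0) = 1%N.
  have /(congr1 absz) := k0'; rewrite abszM => /eqP.
  by rewrite muln_eq1 => /andP[_ /eqP].
have bP e : gcoeff b k0 = e -> b = gscal e k0.
  by move=> <-; apply/groupRingP => h; rewrite gcoeff_gscal; apply: bE.
case: (gcoeff b k0) bP => [n|n] bP /= n1; [left | right].
  by rewrite (bP n%:Z) // n1.
rewrite (bP (Negz n)) // NegzE n1; apply/groupRingP => h.
by rewrite gcoeffN gcoeff_gscal gcoeff_gelt -mulNrn.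
Qed.

Variables (x y : G) (P Q : ZG).
Hypotheses (phi_x : 0 < phi x) (phi_y : 0 < phi y).
Let a : ZG := 1 + P - Q.
Hypotheses (a1 : 1%g \in supp a) (aP : {subset supp P <= supp a})
           (aQ : {subset supp Q <= supp a}).
Hypothesis le_anti : {in supp a &, forall h k, le h k -> le k h -> h = k}.
Hypothesis relations : forall H, exists u v,
  above phi H (u * (gelt x - 1) + v * (gelt y - 1)) /\
  above phi H (v * (1 - Q) - u * P + 1).

Lemma monomial_of_relations : exists z, mu phi a = gelt z \/ mu phi a = - gelt z.
Proof.
have a0 : a != 0 by apply: contraTneq a1 => ->; rewrite supp_gcoeff gcoeff0.
have [k0 k0a low] := exists_lowest phi a0; set m := phi k0 in low.
have m0 : m <= 0 by rewrite -(hom1 phiM); apply: low.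
have FP : above phi m P by move=> h /aP /low.
have FQ : above phi m Q by move=> h /aQ /low.
(* The height [1 - m] exceeds [0] and, once [l + m <= 0] is known, also [l] and [l + m]. *)
have [u [v [FX Frel]]] := relations (1 - m).
have H0 : 0 < 1 - m by lra.
have [k kuv kmin] : exists2 k, k \in supp u \/ k \in supp v &
    above phi (phi k) u /\ above phi (phi k) v.
  have [u0|u0] := eqVneq u 0.
    have [v0|v0] := eqVneq v 0.
      rewrite u0 v0 !mul0r subr0 add0r in Frel.
      by case: (not_above1 H0 Frel).
    have [k kv kmin] := exists_lowest phi v0; exists k; first by right.
    by split => //; rewrite u0; apply: above0.
  have [i iu imin] := exists_lowest phi u0.
  have [v0|v0] := eqVneq v 0.
    by exists i; [left | split => //; rewrite v0; apply: above0].
  have [j jv jmin] := exists_lowest phi v0.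
  have [ij|/ltW ji] := leP (phi i) (phi j).
    by exists i; [left | split => //; apply: above_le jmin].
  by exists j; [right | split => //; apply: above_le imin].
have [Fu Fv] := kmin; set l := phi k in Fu Fv.
(* Otherwise [v * (1 - Q) - u * P] has positive level, and so would [1]. *)
have lm : l + m <= 0.
  rewrite leNgt; apply/negP => lm; pose r := Num.min (1 - m) (l + m).
  have r0 : 0 < r by rewrite lt_min H0 lm.
  have rlm : r <= l + m by rewrite /r ge_min lexx orbT.
  apply: (not_above1 r0).
  rewrite -[1](addKr (v * (1 - Q) - u * P)); apply: aboveD.
    apply/aboveN/aboveB; last exact: above_le (aboveM phiM Fu FP).
    apply: above_le (aboveM phiM Fv _); first exact: rlm.
    by apply: aboveB => //; apply: above1.
  by apply: above_le Frel; rewrite ge_min lexx.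
have Hlm : l < 1 - m by lra.
(* Multiplication by [x] or [y] raises levels, so the terms of [u] and [v] at level [l] must cancel
   each other. In particular [v] reaches this level. *)
have Fsum : strictly_above phi l (u + v).
  rewrite (sum_of_relation (erefl (u * (gelt x - 1) + v * (gelt y - 1)))).
  apply: strictly_aboveD; last by apply/strictly_aboveN/(above_strictly Hlm).
  have gt w : 0 < phi w -> strictly_above phi 0 (gelt w).
    by move=> w0; apply: above_strictly w0 _; apply: above_gelt.
  by apply: strictly_aboveD; rewrite -[l]addr0; apply: strictly_aboveMr => //; apply: gt.
have kv : k \in supp v.
  case: kuv => // ku; apply: contraT => kv.
  have : k \in supp (u + v).
    by rewrite supp_gcoeff gcoeffD (gcoeff_out kv) addr0 -supp_gcoeff.
  by move=> /Fsum; rewrite ltxx.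
have v0 : v != 0 by apply: contraTneq kv => ->; rewrite supp_gcoeff gcoeff0.
(* As [u + v] lies strictly above [l], trading [- u * P] for [v * P] in the second relation changes
   only higher terms. *)
have leadP : strictly_above phi (l + m) (v * a + 1).
  rewrite (relation_regroup P Q u v); apply: strictly_aboveD.
    by apply: above_strictly Frel; lra.
  exact: strictly_aboveMl.
have muv0 : mu phi v != 0.
  apply: (contraTneq _ kv) => e; have := supp_mu k kv Fv; rewrite e eqxx andbT.
  by rewrite supp_gcoeff gcoeff0 eqxx => <-.
exists k0; apply: (@monomial_of_leading_inverse (mu phi v) (mu phi a) l m) => //.
- by rewrite (supp_mu _ k0a low) k0a eqxx.
- exact: mu_homog kv Fv.
- exact: mu_homog k0a low.
- move=> h i; rewrite !(supp_mu _ k0a low) => /andP[ha _] /andP[ia _].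
  exact: le_anti.
have -> : mu phi v * mu phi a + 1 =
    (v * a + 1) - (mu phi v * (a - mu phi a) + (v - mu phi v) * a).
  rewrite (leading_product v a (mu phi v) (mu phi a)).
  by rewrite -[X in _ = X - _]addrA addrK.
apply: strictly_aboveD => //; apply/strictly_aboveN/strictly_aboveD.
  apply: strictly_aboveMr => //; last exact: strictly_above_mu.
  by move=> h /(mu_homog kv Fv) ->.
apply: strictly_aboveMl => //; exact: strictly_above_mu.
Qed.

End LeadingMonomial.

(** * Crossed homomorphisms and derivatives of relators *)

Section CrossedHom.
Variables (H : groupType) (A : pzRingType) (e d : H -> A).
Hypotheses (eM : forall u v, e (u * v)%g = e u * e v) (e1 : e 1%g = 1).
Hypothesis dM : forall u v, d (u * v)%g = d u + e u * d v.

Lemma crossed1 : d 1%g = 0.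
Proof.
have := dM 1%g 1%g; rewrite mulg1 e1 mul1r -[X in X = _]addr0.
by move=> /addrI.
Qed.

Lemma crossedV u : d u^-1%g = - (e u^-1%g * d u).
Proof.
by apply/eqP; rewrite -addr_eq0 -dM mulVg crossed1.
Qed.

Lemma crossed_relator (T J K : H) : e (T^-1 * J * T)%g = e K ->
  d (T^-1 * J * T * K^-1)%g = e T^-1%g * (d J + (e J - 1) * d T) - d K.
Proof.
move=> eK; rewrite dM eK crossedV mulrN mulrA -eM mulgV e1 mul1r; congr (_ - _).
rewrite !dM crossedV eM mulrBl mul1r !mulrDr mulrN mulrA.
by rewrite -addrA addrC -addrA.
Qed.

Lemma crossed_conj h k : e h = 1 -> d (h ^ k)%g = e k^-1%g * d h.
Proof.
move=> eh; rewrite conjgE !dM eh mul1r mulrDr crossedV addrC.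
by rewrite addrK.
Qed.

Lemma crossed_ker_mul h k : e h = 1 -> d (h * k)%g = d h + d k.
Proof. by move=> eh; rewrite dM eh mul1r. Qed.

Lemma crossed_ker_inv h : e h = 1 -> d h^-1%g = -1 * d h.
Proof.
move=> eh; rewrite crossedV mulN1r; congr (- _).
suff -> : e h^-1%g = 1 by rewrite mul1r.
by rewrite -[LHS]mulr1 -[X in _ * X]eh -eM mulVg.
Qed.

(** For the loop [u w u^-1 v^-1]: the transport segments along [u] do not contribute when
    [d u = 0]. *)
Lemma crossed_loop u w v : d u = 0 ->
  d (u * (w * (u^-1 * v^-1)))%g =
  e u * d w - e (u * (w * (u^-1 * v^-1)))%g * d v.
Proof.
move=> du; rewrite !dM !crossedV du mulr0 oppr0 !add0r mulrDr; congr (_ + _).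
by rewrite !mulrN !eM !mulrA.
Qed.

End CrossedHom.

Section TwoVariables.
Variables (A : pzRingType) (x y : A).

Lemma pair_crossed_mul (a b U p q p' q' : A) :
  a = p * x + q * y -> b = p' * x + q' * y ->
  a + U * b = (p + U * p') * x + (q + U * q') * y.
Proof. by move=> -> ->; rewrite mulrDr !mulrDl !mulrA addrACA. Qed.

Lemma pair_crossed_inv (a V p q : A) : a = p * x + q * y ->
  - (V * a) = - (V * p) * x + - (V * q) * y.
Proof. by move=> ->; rewrite mulrDr opprD !mulNr !mulrA. Qed.

(* The pairs of Fox derivatives with respect to the stable letter and to [y] of
   the relations of an HNN extension; [P] and [Q] stand for [t * dg(x)/dy] and
   [t * dg(y)/dy]. *)
Definition relation_pair (P Q pt py : A) := exists u v,
  pt = u * (x - 1) + v * (y - 1) /\ py = v * (1 - Q) - u * P.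

Variables (P Q : A).
Local Notation RP := (relation_pair P Q).

Lemma relation_pair_eq pt py pt' py' :
  RP pt py -> pt' = pt -> py' = py -> RP pt' py'.
Proof. by move=> rp -> ->. Qed.

Lemma relator_congr (T w a b c a' b' c' : A) : a = a' -> b = b' -> c = c' ->
  T * (a + w * b) - c = T * (a' + w * b') - c'.
Proof. by move=> -> -> ->. Qed.

Lemma relation_pair0 : RP 0 0.
Proof. by exists 0, 0; rewrite !mul0r subr0 addr0. Qed.

Lemma relation_pairM r pt py : RP pt py -> RP (r * pt) (r * py).
Proof.
by move=> [u [v [-> ->]]]; exists (r * u), (r * v); rewrite -!mulrA -mulrDr -mulrBr.
Qed.

Lemma relation_pairD pt py pt' py' :
  RP pt py -> RP pt' py' -> RP (pt + pt') (py + py').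
Proof.
move=> [u [v [-> ->]]] [u' [v' [-> ->]]]; exists (u + u'), (v + v').
split; first by rewrite !mulrDl addrACA.
by rewrite !mulrDl opprD addrACA.
Qed.

(** The pair of the relator of [w], with [u = t^-1 * dw/dx] and [v = t^-1 * dw/dy]. The first
    component is the fundamental formula, the second the chain rule [dfox_twist]. *)
Lemma relation_pair_base (T T' w gw p q : A) : T' * T = 1 ->
  w - 1 = p * (x - 1) + q * (y - 1) -> T * gw = p * P + q * Q ->
  RP (T' * (0 + (w - 1) * 1) - 0) (T' * (q + (w - 1) * 0) - gw).
Proof.
move=> TT ew egw; exists (T' * p), (T' * q).
rewrite add0r mulr1 subr0 mulr0 addr0 ew; split; first by rewrite mulrDr !mulrA.
have -> : gw = T' * (p * P + q * Q) by rewrite -egw mulrA TT mul1r.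
by rewrite mulrBr mulr1 mulrDr !mulrA opprD addrA addrAC.
Qed.

End TwoVariables.

(** * Ascending HNN extensions of [F2] *)

Section AscendingHNN.
Variables (R : realType) (G : groupType) (phi : G -> R).
Hypothesis phiM : forall h k, phi (h * k)%g = phi h + phi k.
Variables (g : {multiplicative F2 -> F2}) (g_inj : injective g).
Variables (iota : {multiplicative F2 -> G}) (t : G).
Hypothesis G_hnn : is_hnn g iota t.

Local Notation x := (iota (fgen ix)).
Local Notation y := (iota (fgen iy)).

Definition hnn_gen (o : option 'I_2) : G := if o is Some i then iota (fgen i) else t.

Definition hnn_eval : {multiplicative freeGroup (option 'I_2) -> G} := feval hnn_gen.

Definition base_word : {multiplicative F2 -> freeGroup (option 'I_2)} :=
  feval (fun i : 'I_2 => fgen (Some i)).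

Lemma hnn_eval_gen o : hnn_eval (fgen o) = hnn_gen o.
Proof. exact: feval_gen. Qed.

Lemma hnn_eval_base w : hnn_eval (base_word w) = iota w.
Proof.
apply: (@free_mult_ext _ _ (hnn_eval \o base_word) iota) => s /=.
by rewrite feval_gen feval_gen.
Qed.

Lemma hnn_surj h : exists u, hnn_eval u = h.
Proof. by have [surj _] := G_hnn; apply: surj. Qed.

Lemma hnn_ker u : hnn_eval u = 1%g <-> normal_closure (hnn_rels g) u.
Proof. by have [_ ker] := G_hnn; apply: ker. Qed.

Lemma hnn_conj w : (iota w * t = t * iota (g w))%g.
Proof.
have : hnn_eval ((fgen None)^-1 * base_word w * fgen None * (base_word (g w))^-1)%g = 1%g.
  by apply/hnn_ker => H _; apply; exists w.
rewrite !gmulfM !multV !hnn_eval_base hnn_eval_gen /= => /divg1_eq <-.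
by rewrite !mulgA mulgV mul1g.
Qed.

Lemma hnn_ind (P : G -> Prop) : P 1%g ->
  (forall h k, P h -> P k -> P (h * k)%g) -> (forall h, P h -> P h^-1%g) ->
  (forall w, P (iota w)) -> P t -> forall h, P h.
Proof.
move=> P1 PM PV Pi Pt h; have [u <-] := hnn_surj h.
elim/freeGroup_ind: u => [|[i|]|u v Pu Pv|u Pu].
- by rewrite mult1.
- by rewrite hnn_eval_gen; apply: Pi.
- by rewrite hnn_eval_gen; apply: Pt.
- by rewrite gmulfM; apply: PM.
- by rewrite multV; apply: PV.
Qed.

(** The clauses of [hnn_preorder] apply because [1] and its inverse are both nonnegative. *)
Lemma hnn_separated :
  injective iota /\ forall w, (t * iota w)%g <> 1%g.
Proof.
have [pos [_ tot base stable]] := hnn_preorder g_inj G_hnn.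
have pos1 : pos 1%g by case: (tot 1%g); rewrite ?invg1.
split=> [u v uv|w e]; last by apply: (stable w); rewrite e ?invg1.
apply/divg1_eq/base; rewrite gmulfM multV uv mulgV //.
by rewrite invg1.
Qed.

(** The augmentation ideal is generated by [x - 1], [y - 1] and [t - 1], which expresses that the
    whole Cayley graph is connected. *)
Lemma hnn_combination h :
  combination (gelt x) (gelt y) (gelt t) (gelt h - 1).
Proof.
have [cx cy ct] := combination_gens (gelt x) (gelt y) (gelt t).
move: h; apply: hnn_ind => [|h k ch ck|h ch|w|].
- rewrite gelt1 subrr; exact: combination0.
- rewrite geltM; exact: combination_mul ch ck.
- apply: combination_inv ch; by rewrite -geltM mulVg.
- exists (dfox iota ix w), (dfox iota iy w), 0.
  by rewrite mul0r addr0; apply: dfox_fundamental.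
- exact: ct.
Qed.

Local Notation dA := (dfox iota iy (g (fgen ix))).
Local Notation dB := (dfox iota iy (g (fgen iy))).
Definition hnn_fox : groupRing G := 1 + gelt t * dA - gelt t * dB.

Hypothesis no_common_prefix : forall p : seq (letter 'I_2),
  prefix p (fword (g (fgen ix))) -> prefix p (fword (g (fgen iy))) -> p = [::].

Lemma supp_dfox s w k : k \in supp (dfox iota s w) ->
  exists p, [/\ k = iota p, prefix (fword p) (fword w)
              & fword p = [::] -> prefix [:: (s, false)] (fword w)].
Proof.
move=> /supp_gring_map[p + ->]; rewrite fox_gelt.
by move=> /(fox_word_supp (fwordP w))[pw p0]; exists p.
Qed.

(* The support of a Fox derivative of [w] consists of prefixes of [w], and of
   the empty prefix only if [w] starts with the generator itself. *)
Lemma dfox_disjoint k : k \in supp dA -> k \in supp dB -> False.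
Proof.
move=> /supp_dfox[p [-> pA p0A]] /supp_dfox[q [e qB q0B]].
have pq := (hnn_separated.1 _ _ e); rewrite -pq in qB q0B.
have p0 := no_common_prefix pA qB.
by have := no_common_prefix (p0A p0) (q0B p0).
Qed.

Lemma supp_hnn_fox : [/\ 1%g \in supp hnn_fox,
  {subset supp (gelt t * dA) <= supp hnn_fox},
  {subset supp (gelt t * dB) <= supp hnn_fox}
  & forall h, h \in supp hnn_fox -> h = 1%g \/ exists w, h = (t * iota w)%g].
Proof.
have tS s w : {in supp (dfox iota s w), forall k, (t * k)%g <> 1%g}.
  by move=> k /supp_dfox[p [-> _ _]]; apply: hnn_separated.2.
have [a1 aA aB aE] := supp_stable_combination (tS _ _) (tS _ _) dfox_disjoint.
split; [exact: a1 | exact: aA | exact: aB | move=> h /aE[|[k kAB ->]]; first by left].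
by right; case: kAB => /supp_dfox[p [-> _ _]]; exists p.
Qed.

Hypotheses (phi_x : 0 < phi x) (phi_y : 0 < phi y).

Local Notation ev := hnn_eval.
Local Notation stable := (fgen None : freeGroup (option 'I_2)).
Local Notation lift_gen i := (fgen (Some i) : freeGroup (option 'I_2)).

Lemma dfox_base i w : dfox ev (Some i) (base_word w) = dfox iota i w.
Proof.
elim/freeGroup_ind: w => [|s|u v eu evv|u eu].
- by rewrite mult1 !dfox1.
- have -> : base_word (fgen s) = lift_gen s by exact: feval_gen.
  by rewrite !dfox_gen.
- rewrite (@gmulfM _ _ base_word) (dfoxM ev) (dfoxM iota).
  by congr (_ + gelt _ * _); [exact: eu | exact: hnn_eval_base | exact: evv].
- rewrite (@multV _ _ base_word) (dfoxV ev) (dfoxV iota).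
  by congr (- (gelt _^-1%g * _)); [exact: hnn_eval_base | exact: eu].
Qed.

Lemma dfox_base_stable w : dfox ev None (base_word w) = 0.
Proof.
elim/freeGroup_ind: w => [|s|u v eu evv|u eu].
- by rewrite mult1 dfox1.
- have -> : base_word (fgen s) = lift_gen s by exact: feval_gen.
  by rewrite dfox_gen.
- rewrite (@gmulfM _ _ base_word) (dfoxM ev).
  by apply: etrans (congr2 (fun p q => p + _ * q) eu evv) _; rewrite mulr0 addr0.
- rewrite (@multV _ _ base_word) (dfoxV ev).
  by apply: etrans (congr1 (fun p => - (_ * p)) eu) _; rewrite mulr0 oppr0.
Qed.

(** The chain rule for [g]. The factor [t] converts coefficients [iota (g u)] into [iota u], by
    [hnn_conj]. *)
Lemma dfox_twist s w (P Q : groupRing G) :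
  gelt t * dfox iota s (g (fgen ix)) = P -> gelt t * dfox iota s (g (fgen iy)) = Q ->
  gelt t * dfox iota s (g w) = dfox iota ix w * P + dfox iota iy w * Q.
Proof.
move=> eP eQ; elim/freeGroup_ind: w => [|r|u v eu evv|u eu].
- by rewrite mult1 !dfox1 mulr0 !mul0r addr0.
- rewrite !dfox_gen; case: (eqVneq r ix) => [->|rx].
    by rewrite mul1r mul0r addr0; exact: eP.
  have -> : r = iy by apply/val_inj; case: r rx => -[|[|//]] //= i.
  by rewrite mul1r mul0r add0r; exact: eQ.
- rewrite (@gmulfM _ _ g) (dfoxM iota s) mulrDr mulrA -geltM -hnn_conj geltM -mulrA.
  rewrite (dfoxM iota ix) (dfoxM iota iy); exact: pair_crossed_mul eu evv.
- rewrite (@multV _ _ g) (dfoxV iota s) mulrN mulrA -geltM -2!multV -hnn_conj geltM.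
  rewrite (dfoxV iota ix) (dfoxV iota iy) -mulrA -multV.
  exact: pair_crossed_inv eu.
Qed.

Local Notation RP := (relation_pair (gelt x) (gelt y) (gelt t * dA) (gelt t * dB)).

(** On words evaluating to [1] the derivatives are additive, and conjugation acts by a left factor.
    Hence the words with the stated property form a normal subgroup, and it suffices to treat the
    relators. *)
Lemma relator_pair u : normal_closure (hnn_rels g) u ->
  RP (dfox ev None u) (dfox ev (Some iy) u).
Proof.
pose e u := gelt (ev u).
have eM v w : e (v * w)%g = e v * e w by rewrite /e gmulfM geltM.
have e1 : e 1%g = 1 by rewrite /e mult1 gelt1.
have dM s v w : dfox ev s (v * w)%g = dfox ev s v + e v * dfox ev s w by exact: dfoxM.
have eh1 v : ev v = 1%g -> e v = 1 by rewrite /e => ->; apply: gelt1.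
pose K := [set u | ev u = 1%g /\ RP (dfox ev None u) (dfox ev (Some iy) u)]%classic.
move=> ncu; suff [_ ] : K u by []; move: u ncu.
have K_normal : normal_subgroup K.
  split; first split.
  - split; first exact: mult1.
    exact: relation_pair_eq (relation_pair0 _ _ _ _) (dfox1 _ _) (dfox1 _ _).
  - move=> h k [h1 rh] [k1 rk]; split; first by rewrite gmulfM h1 k1 mulg1.
    exact: relation_pair_eq (relation_pairD rh rk)
      (crossed_ker_mul (dM None) k (eh1 h h1)) (crossed_ker_mul (dM (Some iy)) k (eh1 h h1)).
  - move=> h [h1 rh]; split; first by rewrite multV h1 invg1.
    exact: relation_pair_eq (relation_pairM (-1) rh)
      (crossed_ker_inv eM e1 (dM None) (eh1 h h1))
      (crossed_ker_inv eM e1 (dM (Some iy)) (eh1 h h1)).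
  - move=> h k [h1 rh]; split.
      by rewrite conjgE !gmulfM h1 mul1g multV mulVg.
    exact: relation_pair_eq (relation_pairM (e k^-1%g) rh)
      (crossed_conj e1 (dM None) k (eh1 h h1))
      (crossed_conj e1 (dM (Some iy)) k (eh1 h h1)).
move=> u ncu; apply: (ncu _ K_normal) => _ [w _ <-].
suff : K (stable^-1 * base_word w * stable * (base_word (g w))^-1)%g by [].
have eK : ev (stable^-1 * base_word w * stable)%g = ev (base_word (g w)).
  rewrite !gmulfM multV !hnn_eval_base hnn_eval_gen /=.
  by rewrite -mulgA hnn_conj mulKg.
split; first by rewrite gmulfM eK multV mulgV.
have eT : e stable^-1%g = gelt t^-1%g by rewrite /e multV hnn_eval_gen.
have eJ : e (base_word w) = gelt (iota w) by rewrite /e hnn_eval_base.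
have rel s : dfox ev s (stable^-1 * base_word w * stable * (base_word (g w))^-1)%g =
    gelt t^-1%g * (dfox ev s (base_word w) + (gelt (iota w) - 1) * dfox ev s stable)
    - dfox ev s (base_word (g w)).
  have := crossed_relator eM e1 (dM s) (congr1 (@gelt G) eK).
  by move=> ->; rewrite -eT -eJ.
have rp := relation_pair_base (T := gelt t) (T' := gelt t^-1%g) _
  (dfox_fundamental iota w) (dfox_twist (s := iy) w (erefl _) (erefl _)).
have stN : dfox ev None stable = 1 by rewrite dfox_gen.
have stS : dfox ev (Some iy) stable = 0 by rewrite dfox_gen.
have tV : gelt t^-1%g * gelt t = 1 by rewrite -geltM mulVg.
have rp1 := rp tV; refine (relation_pair_eq rp1 _ _).
- exact: etrans (rel None) (relator_congr _ _
    (dfox_base_stable w) stN (dfox_base_stable (g w))).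
- exact: etrans (rel (Some iy)) (relator_congr _ _
    (dfox_base iy w) stS (dfox_base iy (g w))).
Qed.

(** A path from [1] to [h] whose [t]- and [y]-edges, after cancellation, stay above level [- D]. No
    bound is put on the [x]-edges, which do not enter [relation_pair]. *)
Definition high_word D h := exists u, [/\ ev u = h,
  above phi (- D) (dfox ev None u) & above phi (- D) (dfox ev (Some iy) u)].

Lemma high_word_exists h : exists D, high_word D h.
Proof.
have [u eu] := hnn_surj h.
have [r ar] := above_exists phi (dfox ev None u).
have [s aS] := above_exists phi (dfox ev (Some iy) u).
exists (- Num.min r s), u; rewrite opprK; split; first exact: eu.
  by apply: above_le ar; rewrite ge_min lexx.
by apply: above_le aS; rewrite ge_min lexx orbT.
Qed.

Lemma high_word_le D E h : D <= E -> high_word D h -> high_word E h.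
Proof.
move=> DE [u [eu a1 a2]]; exists u; split; first exact: eu.
  by apply: above_le a1; rewrite lerN2.
by apply: above_le a2; rewrite lerN2.
Qed.

Lemma high_word_seq (s : seq G) : exists D, {in s, forall h, high_word D h}.
Proof.
elim: s => [|h s [D sD]]; first by exists 0.
have [E hE] := high_word_exists h; exists (Num.max D E) => k.
rewrite in_cons => /predU1P[->|/sD].
  by apply: high_word_le hE; rewrite le_max lexx orbT.
by apply: high_word_le; rewrite le_max lexx.
Qed.

Lemma high_wordM D h k : 0 <= phi h -> high_word D h -> high_word D k ->
  high_word D (h * k)%g.
Proof.
move=> h0 [u [eu au au']] [v [ekv av av']]; exists (u * v)%g.
have lift c : above phi (- D) c -> above phi (- D) (gelt h * c).
  by move=> ac; apply: above_le (above_gelt_mul phiM (h := h) ac); rewrite lerDr.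
split; first by rewrite gmulfM eu ekv.
  by rewrite (dfoxM ev None u v) eu; apply/aboveD/lift.
by rewrite (dfoxM ev (Some iy) u v) eu; apply/aboveD/lift.
Qed.

(** Along the inverse of a path in the half space each letter is replaced by a fixed word. The
    vertices have nonnegative level, so one [D] for the finitely many letters serves all [h]. *)
Lemma high_words_of_connected (S : seq G) :
  full_connected (cayley S) (fun h => 0 <= - phi h) ->
  exists D, forall h, 0 <= phi h -> high_word D h.
Proof.
move=> conn.
have [D DS] := high_word_seq (1%g :: S ++ [seq s^-1%g | s <- S]).
exists D => h h0; have V k : 0 <= phi k -> 0 <= - phi k^-1%g.
  by rewrite (homV phiM) opprK.
have V1 : 0 <= - phi 1%g by rewrite (hom1 phiM) oppr0.
have [p [pp pV pl]] := conn _ _ V1 (V _ h0).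
suff : high_word D (last 1%g p)^-1%g by rewrite pl invgK.
have : high_word D 1%g^-1%g by rewrite invg1; apply: DS; rewrite mem_head.
elim: p 1%g V1 pp pV {pl} => //= k p IHp l Vl /andP[lk pp] /andP[Vk pV] Dl.
apply: IHp => //; have l0 : 0 <= phi l^-1%g by rewrite (homV phiM).
have [s sS] := hasP lk; rewrite -/(_ == _) => /orP[/eqP->|/eqP el].
  rewrite invgM; apply: high_wordM => //; apply: DS.
  by rewrite in_cons mem_cat map_f ?orbT.
have -> : k^-1%g = (l^-1 * s)%g by rewrite el invgM mulgVK.
by apply: high_wordM => //; apply: DS; rewrite in_cons mem_cat sS orbT.
Qed.

Lemma relations_of_connected (S : seq G) :
  full_connected (cayley S) (fun h => 0 <= - phi h) -> forall H, exists u v,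
  above phi H (u * (gelt x - 1) + v * (gelt y - 1)) /\
  above phi H (v * (1 - gelt t * dB) - u * (gelt t * dA) + 1).
Proof.
move=> /high_words_of_connected[D words] H.
(* Translation by [x^n] raises the bound [- D] of [high_word] to [H]. *)
have [n Hn] := multiple_ge phi_x (H + D).
pose e u := gelt (ev u).
have eM v w : e (v * w)%g = e v * e w by rewrite /e gmulfM geltM.
have e1 : e 1%g = 1 by rewrite /e mult1 gelt1.
have dM s v w : dfox ev s (v * w)%g = dfox ev s v + e v * dfox ev s w by exact: dfoxM.
pose W := (lift_gen ix ^+ n)%g; pose V := lift_gen iy.
have evW : ev W = (x ^+ n)%g.
  rewrite /W; elim: n {Hn W} => [|n IHn]; first exact: mult1.
  by rewrite !expgS gmulfM IHn hnn_eval_gen.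
have evV : ev V = y by exact: hnn_eval_gen.
have phiW : phi (x ^+ n)%g = phi x *+ n.
  elim: n {Hn W evW} => [|n IHn]; first by rewrite expg0 (hom1 phiM) mulr0n.
  by rewrite expgS phiM IHn mulrS.
have dW s : s != Some ix -> dfox ev s W = 0.
  move=> ne; rewrite /W; elim: n {Hn W evW phiW} => [|n IHn]; first exact: dfox1.
  rewrite expgS (dfoxM ev) (dfox_gen ev) eq_sym (negbTE ne) add0r.
  by apply: etrans (congr1 (fun c => _ * c) IHn) _; rewrite mulr0.
(* This element has level [phi y > 0]. Its word [u], translated by [x^n], is the path from [x^n] to
   [y x^n]. *)
have [|u [evu aN aS]] := words ((x ^+ n)^-1 * y * x ^+ n)%g.
  by rewrite !phiM (homV phiM) addrAC addNr add0r ltW.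
(* The sides [W] and [W^-1] have no [t]- or [y]-derivative, so only the high path and the edge [V]
   contribute; [V] accounts for the [+ 1] in the second relation. *)
pose L := (W * (u * (W^-1 * V^-1)))%g.
have evL : ev L = 1%g.
  rewrite /L !gmulfM !multV evW evV evu.
  by rewrite !mulgA mulgV mul1g mulgK mulgV.
have [a [b [eN eS]]] := relator_pair ((hnn_ker L).1 evL).
have loop s : s != Some ix -> dfox ev s L = gelt (x ^+ n)%g * dfox ev s u - dfox ev s V.
  move=> ne; apply: etrans (crossed_loop eM e1 (dM s) u V (dW s ne)) _.
  by rewrite /e evW -/L evL gelt1 mul1r.
have lift c : above phi (- D) c -> above phi H (gelt (x ^+ n)%g * c).
  move=> ac; apply: above_le (above_gelt_mul phiM ac).
  by rewrite phiW lerBrDr.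
have VN : dfox ev None V = 0 by rewrite dfox_gen.
have VS : dfox ev (Some iy) V = 1 by rewrite dfox_gen eqxx.
exists a, b; split.
  rewrite -eN; apply: (eq_ind _ (above phi H) (lift _ aN)).
  by apply/esym/(etrans (loop None isT)); rewrite VN subr0.
rewrite -eS; apply: (eq_ind _ (above phi H) (lift _ aS)).
apply/esym/(etrans (congr1 (fun c => c + 1) (loop (Some iy) isT))).
by rewrite VS subrK.
Qed.

Local Notation a := hnn_fox.
Variable S : seq G.

Lemma monomial_of_connected :
  full_connected (cayley S) (fun h => 0 <= - phi h) ->
  exists z, mu phi a = gelt z \/ mu phi a = - gelt z.
Proof.
move=> conn; have [pos [posM pos_tot pos_base pos_stable]] := hnn_preorder g_inj G_hnn.
have [a1 aA aB aE] := supp_hnn_fox.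
pose le h k := pos (h^-1 * k)%g.
have le_total h k : le h k \/ le k h.
  by have := pos_tot (h^-1 * k)%g; rewrite invgM invgK.
have le_trans h k l : le h k -> le k l -> le h l.
  by move=> hk kl; have := posM _ _ hk kl; rewrite mulgA mulgK.
have le_mul h k l : le k l -> le (h * k)%g (h * l)%g.
  by rewrite /le invgM -mulgA mulKg.
have stableE v w : ((t * iota v)^-1 * (t * iota w) = iota (v^-1 * w))%g.
  by rewrite invgM -mulgA mulKg gmulfM multV.
(* Every point of the support is [1] or some [t * iota v], so two points differ by [t * iota w], its
   inverse, or [iota w], and the preorder separates them. *)
have le_anti : {in supp a &, forall h k, le h k -> le k h -> h = k}.
  move=> h k /aE[->|[v ->]] /aE[->|[w ->]] //; rewrite /le ?invg1 ?mul1g ?mulg1.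
  - by move=> pw /(pos_stable w pw).
  - by move=> nv pv; case: (pos_stable v pv nv).
  rewrite !stableE => vw wv; congr (_ * iota _)%g.
  have e : (v^-1 * w = 1)%g.
    by apply: (pos_base _ vw); rewrite -multV invgM invgK.
  by rewrite -[w](mulVKg v) e mulg1.
apply: (monomial_of_relations phiM le_total le_trans le_mul phi_x phi_y a1 aA aB le_anti).
exact: relations_of_connected conn.
Qed.

Hypothesis phi_neq0 : exists h, phi h != 0.
Hypothesis S_gen : generated [set s | s \in S]%classic = [set: G]%classic.

Lemma connected_of_monomial z : mu phi a = gelt z \/ mu phi a = - gelt z ->
  full_connected (cayley S) (fun h => 0 <= - phi h).
Proof.
move=> mu_z; have [a1 aA _ _] := supp_hnn_fox.
have a0 : a != 0 by apply: contraTneq a1 => ->; rewrite supp_gcoeff gcoeff0.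
have [k ka low] := exists_lowest phi a0.
have kz : k = z.
  have : k \in supp (mu phi a) by rewrite (supp_mu _ ka low) ka eqxx.
  by case: mu_z => ->; rewrite ?suppN supp_gelt in_fset1 => /eqP.
rewrite kz in ka low; have lead := strictly_above_mu ka low.
have FA : above phi (phi z) (gelt t * dfox iota iy (g (fgen ix))) by move=> h /aA/low.
have [e' e'e Fe'] : exists2 e', e' * mu phi a = 1 & above phi (- phi z) e'.
  have zV : above phi (- phi z) (gelt z^-1%g) by apply: above_gelt; rewrite (homV phiM).
  have zz : gelt z^-1%g * gelt z = 1 by rewrite -geltM mulVg.
  case: mu_z => ->; first by exists (gelt z^-1%g).
  by exists (- gelt z^-1%g); [rewrite mulrNN | apply: aboveN].
apply: (connected_of_chains phiM phi_neq0 S_gen) => N h l Nh Nl.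
exact: (chains_of_monomial phiM (hnn_conj _) (hnn_conj _)
  (dfox_fundamental iota _) (dfox_fundamental iota _) phi_x phi_y
  hnn_combination e'e Fe' lead FA Nh Nl).
Qed.

End AscendingHNN.

Theorem theorem5p8 (R : realType) (G : groupType) (phi : G -> R)
    (phi_hom : nonzero_hom phi)
    (g : {multiplicative F2 -> F2}) (g_inj : injective g)
    (iota : {multiplicative F2 -> G}) (t : G)
    (G_hnn : is_hnn g iota t)
    (phi_x : 0 < phi (iota (fgen ix))) (phi_y : 0 < phi (iota (fgen iy)))
    (no_common_prefix : forall p : seq (letter 'I_2),
       prefix p (fword (g (fgen ix))) -> prefix p (fword (g (fgen iy))) ->
       p = [::])
    (S : seq G) (S_gen : generated [set s | s \in S]%classic = [set: G]%classic) :
  Sigma S (ray (fun h => - phi h)) <->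
  exists z : G,
    let a : groupRing G :=
      1 + gelt t * gring_map iota (fox iy (gelt (g (fgen ix))))
        - gelt t * gring_map iota (fox iy (gelt (g (fgen iy)))) in
    mu phi a = gelt z \/ mu phi a = - gelt z.
Proof.
have [phiM [h0 h0_neq0]] := phi_hom; split; last first.
  move=> [z mu_z]; exists (fun h => - phi h) => //; split.
    split; first by move=> h k; rewrite phiM opprD.
    by exists h0; rewrite oppr_eq0.
  by apply: connected_of_monomial mu_z => //; exists h0.
move=> [psi [_ conn] ray_psi].
(* Membership in [Sigma] provides some representative [psi] of the ray. It is a positive multiple of
   [- phi] and thus has the same half space. *)
have [c c0 psiE] : ray (fun h => - phi h) psi.
  by rewrite -ray_psi; exists 1 => // h; rewrite mul1r.
have := @monomial_of_connected R G phi phiM g g_inj iota t G_hnn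
  no_common_prefix phi_x phi_y S; apply.
have psi_sign h : (0 <= psi h) = (0 <= - phi h) by rewrite psiE pmulr_rge0.
move=> h k; rewrite -!psi_sign => hV kV.
have [p [pp pV pl]] := conn h k hV kV; exists p; split => //.
by rewrite -(eq_all psi_sign).
Qed.
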